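(* In the setting described in the context, the total energy of the wave system $$\partial_t\eta+\nabla_X\cdot(\bar U\eta)=\mathcal G(b)\varphi,\qquad \partial_t\varphi+\bar U\cdot\nabla_X\varphi=-g\eta$$ (for real-valued quantities with sufficient smoothness and decay at infinity) satisfies the evolution equation $$\frac{\mathrm d}{\mathrm dt}\int_{\mathbb R^2}\mathcal E\,\mathrm dX=-\int_{\mathbb R^2}\nabla_X\cdot\bar U\,\tfrac12g|\eta|^2\,\mathrm dX+\int_{\Omega(0,b)}\mathcal P\,\mathrm dz\,\mathrm dX,$$ where $\mathcal P=-\bm u\cdot S(\bar{\bm U})\bm u$ is the production term related to the bulk interaction of the background current $\bar{\bm U}$ and the wave velocity $\bm u$.
   Context: Coordinates are $(X,z)\in\mathbb R^2\times\mathbb R$, $\nabla_{X,z}=(\nabla_X,\partial_z)^\top$, and $g>0$ is the gravitational acceleration. The fluid is incompressible and governed by the Euler equations, with no flow through the bottom and atmospheric pressure at the free surface. The depth $b:\mathbb R^2\to\mathbb R$ is time-independent, smooth and bounded with $0<b_{\min}\le b\le b_{\max}$, and $b(X)=b_{\max}$ for $|X|$ larger than some finite $R$. Write $\Omega(0,b)=\{(X,z):-b(X)<z<0\}$, and let $\nu$ be the downward unit normal of the bottom. Background current: $\bar{\bm U}(t,X,z)=(\bar U,\bar W)$, with $\bar U=(\bar U_1,\bar U_2)$, is smooth, divergence free, satisfies $\nu\cdot\bar{\bm U}|_{z=-b}=0$, and is slowly varying with parameter $0<\delta<1$: $|D^\alpha\bar U_j|=\mathcal O(\delta^{|\alpha|})$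 and $|D^\alpha\bar W|=\mathcal O(\delta^{|\alpha|})$ for every multi-index $\alpha$ in $(x_1,x_2,z)$. It supports a background surface elevation $\bar\eta\sim\delta$ with $|\partial_t\bar\eta|=\mathcal O(\delta)$ and $|\nabla_X\bar\eta|=\mathcal O(\delta)$, and the associated background pressure equals the given atmospheric pressure at $z=\bar\eta$. Its vorticity $\nabla_{X,z}\times\bar{\bm U}$ is $\mathcal O(\delta)$ and vanishes for $|X|$ larger than some fixed radius. In the wave system and in integrals over $\mathbb R^2$, $\bar U$ denotes the horizontal current evaluated at $z=0$. Waves: $\eta$ is the wave surface elevation and $\varphi$ the surface velocity potential. The wave quantities are small, with linearization parameter $0<\varepsilon\ll1$: $\eta\sim\varepsilon$, $|\nabla_X\eta|\sim\varepsilon$, $|\bm u|=\mathcal O(\varepsilon)$; the wave perturbation is initially irrotational, and to leading order its velocity is $\bm u=\nabla_{X,z}\phi$, where $\phi$ solves $\Delta_{X,z}\phi=0$ in $\Omega(0,b)$, $\phi|_{z=0}=\varphi$, $\partial_\nu\phi|_{z=-b}=0$. The wave system above is the leading-order linear system, obtained by discarding $\mathcal O(\varepsilon\delta)$ terms. The Dirichlet-to-Neumann operator is $\mathcal G(b)\varphi=\partial_z\phi|_{z=0}$. Energy density (with fluid density $\rho=1$): $\mathcal E=\frac12\left(g|\eta|^2+\varphi\,\mathcal G(b)\overline\varphi\right)$. Strain tensor: $S(\bar{\bm U})=\frac12\left(\nabla_{X,z}\bar{\bm U}+(\nabla_{X,z}\bar{\bm U})^\top\right)$.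
   Formalization: The equality fails if the vertical current W at z=0 is nonzero; proved instead: the equality with the extra term ½∫W|_{z=0}((Gφ)²−|∇φ|²)dX on the right, bounded by Cδ∫|u|²|_{z=0}dX with uniform C; the displayed equality holds when W=0 on z=0. *)

(* Defs.v *)
From mathcomp Require Import all_boot all_order all_algebra.
From mathcomp Require Import all_classical all_reals all_analysis.

Set Implicit Arguments.
Unset Strict Implicit.
Unset Printing Implicit Defensive.

Import Order.TTheory GRing.Theory Num.Theory.
Import numFieldNormedType.Exports.

Local Open Scope classical_set_scope.
Local Open Scope ring_scope.

(* Points: X : plane R, (t, X) : surfpt R, (t, X, z) : bulkpt R. *)
Notation plane R := (R * R)%type (only parsing).
Notation surfpt R := (R * (R * R))%type (only parsing).
Notation bulkpt R := (R * (R * R) * R)%type (only parsing).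

Section Calculus.
Variable R : realType.

Definition ex (j : 'I_2) : plane R := nth 0 [:: (1, 0); (0, 1)] j.
Definition es (j : 'I_2) : surfpt R := (0, ex j).
Definition est : surfpt R := (1, 0).
Definition eb (i : 'I_3) : bulkpt R :=
  nth 0 [:: (es ord0, 0); (es ord_max, 0); (0, 1)] i.
Definition ebt : bulkpt R := (est, 0).

(* The horizontal directions 0, 1 and the vertical direction 2 among 'I_3. *)
Definition hor (j : 'I_2) : 'I_3 := lift ord_max j.
Definition ver : 'I_3 := ord_max.

Definition iter_deriv (V : normedModType R) (vs : seq V) (f : V -> R) : V -> R :=
  foldr (fun v g => 'D_v g) f vs.

(* C^k on the open set O; in finite dimension this is the usual notion. *)
Definition Ck_on (V : normedModType R) (k : nat) (O : set V) (f : V -> R) :=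
  forall vs : seq V, (size vs <= k)%N -> forall p, O p ->
    {for p, continuous (iter_deriv vs f)} /\
    ((size vs < k)%N -> forall v, derivable (iter_deriv vs f) p v).

(* C^k, resp. smooth, up to the boundary of A: the values of f outside A form
   an extension to some neighbourhood of A. *)
Definition Ck_near (V : normedModType R) (k : nat) (A : set V) (f : V -> R) :=
  exists O, [/\ open O, A `<=` O & Ck_on k O f].
Definition smooth_near (V : normedModType R) (A : set V) (f : V -> R) :=
  exists O, [/\ open O, A `<=` O & forall k, Ck_on k O f].

Definition grad (f : bulkpt R -> R) (p : bulkpt R) : 'cV[R]_3 :=
  \col_i 'D_(eb i) f p.
Definition laplacian (f : bulkpt R -> R) (p : bulkpt R) : R :=
  \sum_(i < 3) 'D_(eb i) ('D_(eb i) f) p.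
Definition divergence (U : 'I_3 -> bulkpt R -> R) (p : bulkpt R) : R :=
  \sum_(i < 3) 'D_(eb i) (U i) p.
(* Indices are taken in Z/3. *)
Definition curl (U : 'I_3 -> bulkpt R -> R) (i : 'I_3) (p : bulkpt R) : R :=
  'D_(eb (i + 1)) (U (i + 2)) p - 'D_(eb (i + 2)) (U (i + 1)) p.
Definition jac (U : 'I_3 -> bulkpt R -> R) (p : bulkpt R) : 'M[R]_3 :=
  \matrix_(i, j) 'D_(eb j) (U i) p.
Definition strain (U : 'I_3 -> bulkpt R -> R) (p : bulkpt R) : 'M[R]_3 :=
  2^-1 *: (jac U p + (jac U p)^T).

Definition trace0 (f : bulkpt R -> R) (q : surfpt R) : R := f (q, 0).

Definition div_trace0 (U : 'I_3 -> bulkpt R -> R) (q : surfpt R) : R :=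
  \sum_(j < 2) 'D_(es j) (trace0 (U (hor j))) q.

Definition enorm (X : plane R) : R := Num.sqrt (X.1 ^+ 2 + X.2 ^+ 2).

End Calculus.

Arguments est {R}.
Arguments ebt {R}.

Section Geometry.
Variable R : realType.

Record bathymetry (bmin bmax R0 : R) (b : plane R -> R) : Prop := Bathymetry {
  bathy_smooth : smooth_near setT b;
  bathy_min_gt0 : 0 < bmin;
  bathy_bounds : forall X, bmin <= b X <= bmax;
  bathy_far : forall X, R0 < enorm X -> b X = bmax }.

Definition Omega (b : plane R -> R) : set (plane R * R) :=
  [set Y | - b Y.1 < Y.2 < 0].

(* Downward unit normal of the graph z = -b(X). *)
Definition bottom_normal (b : plane R -> R) (X : plane R) : 'cV[R]_3 :=
  - (Num.sqrt (1 + \sum_(j < 2) ('D_(ex R j) b X) ^+ 2))^-1 *: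
  \col_i oapp (fun j => 'D_(ex R j) b X) 1 (unlift (ver) i).

Definition bottom (b : plane R -> R) (q : surfpt R) : bulkpt R := (q, - b q.2).

Definition layer (T : R) (b : plane R -> R) (s : surfpt R -> R) :
    set (bulkpt R) :=
  [set p | [/\ 0 < p.1.1 < T, - b p.1.2 <= p.2 & p.2 <= s p.1]].

Definition during (T : R) : set (surfpt R) := [set q | 0 < q.1 < T].

End Geometry.

Section Background.
Variable R : realType.

(* The elevation etab is only O(delta) and may be negative, while the current
   is evaluated at z = 0 and integrated over all of Omega(0, b). The velocity is
   therefore taken in the layer -b <= z <= max(0, etab), and the momentum
   equation in the fluid, -b <= z <= etab. The constants K, Ks quantify the
   O(.) symbols; they are fixed before all other data. *)
Record background_current (K : nat -> R) (Ks : R) (g delta T : R)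
    (b : plane R -> R) (U : 'I_3 -> bulkpt R -> R) (etab : surfpt R -> R)
    (press : bulkpt R -> R) (patm : surfpt R -> R) : Prop := BackgroundCurrent {
  bg_smooth : forall i,
    smooth_near (layer T b (fun q => Num.max 0 (etab q))) (U i);
  bg_elev_smooth : smooth_near (during T) etab;
  bg_press_smooth : smooth_near (layer T b etab) press;
  bg_elev_bottom : forall q, during T q -> - b q.2 < etab q;
  bg_divfree : forall p, layer T b (fun q => Num.max 0 (etab q)) p ->
    divergence U p = 0;
  bg_bottom : forall q, during T q ->
    \sum_(i < 3) bottom_normal b q.2 i 0 * U i (bottom b q) = 0;
  bg_slow : forall (i : 'I_3) (alpha : seq 'I_3) p,
    layer T b (fun q => Num.max 0 (etab q)) p ->
    `| iter_deriv [seq eb R a | a <- alpha] (U i) p |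
      <= K (size alpha) * delta ^+ size alpha;
  bg_euler : forall (i : 'I_3) p, layer T b etab p ->
    'D_ebt (U i) p + \sum_(j < 3) U j p * 'D_(eb R j) (U i) p
      = - 'D_(eb R i) press p - (if i == ver then g else 0);
  bg_kinematic : forall q, during T q ->
    'D_est etab q + \sum_(j < 2) U (hor j) (q, etab q) * 'D_(es R j) etab q
      = U ver (q, etab q);
  bg_dynamic : forall q, during T q -> press (q, etab q) = patm q;
  bg_elev_size : forall q, during T q -> `| etab q | <= Ks * delta;
  bg_elev_dt : forall q, during T q -> `| 'D_est etab q | <= Ks * delta;
  bg_elev_dx : forall j q, during T q -> `| 'D_(es R j) etab q | <= Ks * delta;
  bg_vort_size : forall i p, layer T b (fun q => Num.max 0 (etab q)) p ->
    `| curl U i p | <= Ks * delta;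
  bg_vort_supp : exists r : R, forall i p,
    layer T b (fun q => Num.max 0 (etab q)) p -> r < enorm p.1.2 ->
    curl U i p = 0 }.

End Background.

Section Waves.
Variable R : realType.

(* Phi is the time-dependent potential in the bulk, phi its trace at z = 0. *)
Record wave_potential (T : R) (b : plane R -> R) (phi : surfpt R -> R)
    (Phi : bulkpt R -> R) : Prop := WavePotential {
  pot_harmonic : forall p, during T p.1 -> - b p.1.2 < p.2 < 0 ->
    laplacian Phi p = 0;
  pot_surface : forall q, during T q -> Phi (q, 0) = phi q;
  pot_bottom : forall q, during T q ->
    \sum_(i < 3) bottom_normal b q.2 i 0 * grad Phi (bottom b q) i 0 = 0 }.

(* G(b)phi, for Phi the solution of the boundary value problem with data phi. *)
Definition DtN (Phi : bulkpt R -> R) (q : surfpt R) : R :=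
  'D_(eb R ver) Phi (q, 0).

(* Regularity and decay: quadratic expressions in eta and u, and their first
   derivatives, are integrable in X, locally uniformly in time. *)
Record wave_regular (T : R) (b : plane R -> R) (eta : surfpt R -> R)
    (Phi : bulkpt R -> R) : Prop := WaveRegular {
  reg_eta : Ck_near 1 (during T) eta;
  reg_Phi : Ck_near 3 (layer T b (cst 0)) Phi;
  reg_eta_decay : exists M : R, forall vs q,
    {subset vs <= est :: [seq es R j | j : 'I_2]} -> (size vs <= 1)%N ->
    during T q -> `| iter_deriv vs eta q | <= M / (1 + enorm q.2 ^+ 2);
  reg_Phi_decay : exists M : R, forall vs p,
    {subset vs <= ebt :: [seq eb R i | i : 'I_3]} -> (size vs <= 3)%N ->
    layer T b (cst 0) p ->
    `| iter_deriv vs Phi p | <= M / (1 + enorm p.1.2 ^+ 2) }.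

Record wave_small (Kw eps T : R) (b : plane R -> R) (eta : surfpt R -> R)
    (Phi : bulkpt R -> R) : Prop := WaveSmall {
  small_eta : forall q, during T q -> `| eta q | <= Kw * eps;
  small_eta_dx : forall j q, during T q -> `| 'D_(es R j) eta q | <= Kw * eps;
  small_u : forall i p, layer T b (cst 0) p -> `| grad Phi p i 0 | <= Kw * eps }.

Record wave_system (g T : R) (U : 'I_3 -> bulkpt R -> R)
    (eta phi : surfpt R -> R) (Phi : bulkpt R -> R) : Prop := WaveSystem {
  wave_eta : forall q, during T q ->
    'D_est eta q
      + \sum_(j < 2) 'D_(es R j) (fun q' => trace0 (U (hor j)) q' * eta q') q
    = DtN Phi q;
  wave_phi : forall q, during T q ->
    'D_est phi q + \sum_(j < 2) trace0 (U (hor j)) q * 'D_(es R j) phi q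
    = - g * eta q }.

Local Notation leb2 := (@lebesgue_measure R \x @lebesgue_measure R)%E.
Local Notation leb3 :=
  ((@lebesgue_measure R \x @lebesgue_measure R) \x @lebesgue_measure R)%E.

Definition energy_density (g : R) (eta phi : surfpt R -> R)
    (Phi : bulkpt R -> R) (q : surfpt R) : R :=
  2^-1 * (g * `| eta q | ^+ 2 + phi q * DtN Phi q).

Definition total_energy (g : R) (eta phi : surfpt R -> R)
    (Phi : bulkpt R -> R) (t : R) : R :=
  \int[leb2]_X energy_density g eta phi Phi (t, X).

Definition production (U : 'I_3 -> bulkpt R -> R) (Phi : bulkpt R -> R)
    (p : bulkpt R) : R :=
  - ((grad Phi p)^T *m (strain U p *m grad Phi p)) 0 0.

Definition energy_rate (g : R) (b : plane R -> R) (U : 'I_3 -> bulkpt R -> R)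
    (eta : surfpt R -> R) (Phi : bulkpt R -> R) (t : R) : R :=
  - (\int[leb2]_X (div_trace0 U (t, X) * (2^-1 * g * `| eta (t, X) | ^+ 2)))
  + (\int[leb3]_(Y in Omega b) production U Phi (t, Y.1, Y.2)).

(* With W the vertical component of U, the integral over X of
   1/2 W ((d_z Phi)^2 - |grad_X phi|^2) at z = 0. It is the part of the flux of
     div ((u . U) u - 1/2 |u|^2 U) = u . S(U) u
   through z = 0 that the linear wave system does not account for: the terms
   W d_z Phi = O(eps * delta) have been discarded there, W being O(delta) at
   z = 0 by the kinematic condition at the background surface. *)
Definition surface_residue (U : 'I_3 -> bulkpt R -> R) (phi : surfpt R -> R)
    (Phi : bulkpt R -> R) (t : R) : R :=
  \int[leb2]_X (2^-1 * trace0 (U ver) (t, X) *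
    ((DtN Phi (t, X)) ^+ 2 - \sum_(j < 2) ('D_(es R j) phi (t, X)) ^+ 2)).

Definition surface_speed2 (Phi : bulkpt R -> R) (t : R) : R :=
  \int[leb2]_X (\sum_(i < 3) (grad Phi (t, X, 0) i 0) ^+ 2).

End Waves.

(* Main.v *)
(* Two vector fields are tangent to the bottom, so that by the divergence
   theorem the integral of their divergence over the bulk is the integral of
   their vertical component over z = 0.

   The first is Phi grad(Phi_t) - Phi_t grad(Phi). It is divergence free, hence
   the Dirichlet-to-Neumann operator G is symmetric and the time derivative of
   the energy is the integral of g eta eta_t + phi_t G phi. Inserting the wave
   system gives -g eta div(U eta) - (U . grad phi) G phi, and the first term
   integrates to minus that of (1/2) g eta^2 div U.

   The second is (1/2) |u|^2 U - (u . U) u with u = grad Phi. As u is divergence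
   and curl free and U is divergence free, its divergence is -u . S(U) u. Its
   vertical component at z = 0 is -(U . grad phi) G phi minus the density of the
   surface residue, which is proportional to the vertical current there and
   hence O(delta).

   The divergence theorem is proved in the coordinates (X, s), z = s b(X), where
   the bulk becomes a slab: the horizontal derivatives integrate to zero by
   decay, the vertical one by the fundamental theorem of calculus. *)
From HB Require Import structures.
Require Import Defs.
From mathcomp Require Import all_boot all_order all_algebra.
From mathcomp Require Import all_classical all_reals all_analysis.
From mathcomp Require Import measurable_realfun.
From mathcomp Require Import ring lra.
Set Implicit Arguments.
Unset Strict Implicit.
Unset Printing Implicit Defensive.
Import Order.TTheory GRing.Theory Num.Theory.
Import numFieldNormedType.Exports.
Local Open Scope classical_set_scope.
Local Open Scope ring_scope.

(** The hypotheses speak of directional derivatives only, so the chain rule along the graphs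
    [z = s b(X)] and the symmetry of second derivatives are derived from the mean value theorem in
    one variable, without Frechet differentials. The potential and the current are given near a
    layer with boundary; clamping the vertical variable turns them into continuous, hence
    measurable, functions on the whole space.

    Flattening lets horizontal derivatives be integrated at fixed height: every slice of the slab is
    the whole plane, so the sloping bottom leaves no boundary term there, and tangency to the bottom
    enters only at [s = -1]. The wave decays like [1/(1+|X|^2)], which is not integrable over the
    plane, but the integrands are quadratic in the wave, and the square of this rate lies below a
    product of functions of one variable. Hence the restrictions to all lines and all slices are
    integrable, and iterated real integrals need no exceptional null sets. *)

Lemma distr_lt_half (R : realType) (x y z e : R) :
  `|x - z| < e / 2 -> `|y - z| < e / 2 -> `|x - y| < e.
Proof.
move=> xz yz; rewrite -(subrKA z) (le_lt_trans (ler_normD _ _))//.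
by rewrite [e]splitr ltrD// distrC.
Qed.

Lemma is_derive_mulr (R : realType) (b s : R) :
  is_derive s 1 (fun s : R => s * b) b.
Proof.
have H := @is_deriveM R R id (cst b) s 1 1 0 (is_derive_id _ _) (is_derive_cst _ _ _).
by apply: is_derive_eq H _; rewrite scaler0 add0r [_ *: _]mulr1.
Qed.

(** * Directional derivatives and functions of class C^1 *)

Section DirectionalCalculus.
Variables (R : realType) (V : normedModType R).
Implicit Types (f g : V -> R) (p v w : V) (O : set V).

Lemma is_derive_line f p v (s : R) : derivable f (p + s *: v) v ->
  is_derive s 1 (fun h : R => f (p + h *: v)) ('D_v f (p + s *: v)).
Proof.
move=> df.
have E : (fun h : R => h^-1 *: (((fun h : R => f (p + h *: v)) \o shift s) (h *: 1)
    - f (p + s *: v))) =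
   (fun h => h^-1 *: ((f \o shift (p + s *: v)) (h *: v) - f (p + s *: v))).
  apply/funext => h /=; congr (_ *: (f _ - _)).
  by rewrite [h *: 1]mulr1 scalerDl addrCA.
by apply: DeriveDef; [rewrite /derivable E; exact: df|rewrite /derive E].
Qed.

Lemma mvt0 (f df : R -> R) (h : R) : 0 < h ->
  (forall s, 0 <= s <= h -> is_derive s 1 f (df s)) ->
  exists2 c, 0 < c < h & f h - f 0 = df c * h.
Proof.
move=> h0 d.
have [||c] := @MVT R f df 0 h h0.
- by move=> x /[!in_itv]/= /andP[x0 xh]; apply: d; rewrite !ltW.
- apply: derivable_within_continuous => x /[!in_itv]/= xh.
  by have := d _ xh => -[].
- by rewrite in_itv/= subr0 => ch e; exists c.
Qed.

(** Parametrising by the unit interval covers every sign of [h], including [h = 0], and keeps the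
    intermediate point on the segment from [p] to [p + h *: v]. *)
Lemma mvt_segment f p v (h : R) :
  (forall s, 0 <= s <= 1 -> derivable f (p + (s * h) *: v) v) ->
  exists2 s, 0 < s < 1 & f (p + h *: v) - f p = h * 'D_v f (p + (s * h) *: v).
Proof.
move=> d.
have [|s Ps] := @mvt0 (fun s => f (p + (s * h) *: v))
   (fun s => h *: 'D_v f (p + (s * h) *: v)) 1 ltr01.
  move=> s /d dl.
  have dm := is_derive_mulr h s.
  have := is_derive1_comp (f := fun h : R => f (p + h *: v)) (g := fun s : R => s * h)
    (is_derive_line dl) dm.
  by move=> H; apply: is_derive_eq H _; rewrite mulrC.
by rewrite mul1r mul0r scale0r addr0 mulr1 => e; exists s.
Qed.

Lemma mvt_line f p v (h : R) :
  (forall s, `|s| <= `|h| -> derivable f (p + s *: v) v) ->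
  exists2 c, `|c| <= `|h| & f (p + h *: v) - f p = h * 'D_v f (p + c *: v).
Proof.
move=> d; have [|s /andP[s0 s1] e] := @mvt_segment f p v h.
  by move=> s /andP[s0 s1]; apply: d; rewrite normrM ger0_norm// ler_piMl.
by exists (s * h); rewrite // normrM (gtr0_norm s0) ler_piMl// ltW.
Qed.

(** The chain rule and the exchange of derivatives move only within the plane through [p] spanned by
    [v] and [w], so a square of parameters replaces a neighbourhood of [p]. *)
Lemma near_plane p v w (P : V -> Prop) : (\forall q \near p, P q) ->
  exists2 e : R, 0 < e & forall h k : R, `|h| < e -> `|k| < e ->
    P (p + h *: v + k *: w).
Proof.
move=> nP.
have : \forall x \near (0 : R * R), P (p + x.1 *: v + x.2 *: w).
  have c : (p + x.1 *: v + x.2 *: w) @[x --> (0 : R * R)] --> p.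
    rewrite -[X in _ --> X]addr0 -[X in _ --> X + _]addr0.
    apply: cvgD; first apply: cvgD; first exact: cvg_cst.
    - rewrite -(scale0r v); apply: cvgZr_tmp; exact: cvg_fst.
    - rewrite -(scale0r w); apply: cvgZr_tmp; exact: cvg_snd.
  exact: c nP.
move=> /nbhs_ballP[e /= e0 He]; exists e => // h k he ke.
by apply: (He (h, k)); split => /=; rewrite /ball/= sub0r normrN.
Qed.

(** The increment is split at [p + h *: v]. The part along [v] needs the derivative at [p] alone;
    the part along [w] is handled by the mean value theorem and the continuity of ['D_w f] at
    [p]. *)
Lemma is_derive_chain2 f p v w (k : R -> R) (k' : R) :
  derivable f p v -> (\forall q \near p, derivable f q w) ->
  {for p, continuous ('D_w f)} -> k 0 = 0 -> is_derive (0 : R) 1 k k' ->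
  is_derive (0 : R) 1 (fun h : R => f (p + h *: v + k h *: w))
    ('D_v f p + k' * 'D_w f p).
Proof.
move=> dv dw cw k0 dk.
(* The slope along [w], with its limit as default value where [k h = 0]. The increment along [w] is
   then [k h * D h] for every [h], and no assumption that [k] avoids 0 is needed. *)
pose D (h : R) := if k h == 0 then 'D_w f p else
  (f (p + h *: v + k h *: w) - f (p + h *: v)) / k h.
have ck : k h @[h --> 0^'] --> 0.
  rewrite -[X in _ --> X]k0; apply: cvg_within_filter.
  by apply/differentiable_continuous/derivable1_diffP; case: dk.
have cD : D h @[h --> 0^'] --> 'D_w f p.
  apply/cvgrPdist_lt => e e0.
  have [r r0 Hr] := near_plane v w (filterI dw ((cvgrPdist_lt _ _).1 cw e e0)).
  near=> h.
  rewrite /D; case: eqP => [_|/eqP kh]; first by rewrite subrr normr0.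
  have hr : `|h| < r.
    by near: h; apply: dnbhs0_lt.
  have kr : `|k h| < r by near: h; exact: cvgr0_norm_lt ck _ r0.
  have [|c ch ->] := @mvt_line f (p + h *: v) w (k h).
    by move=> s sh; apply: (Hr _ _ hr _).1; exact: le_lt_trans sh kr.
  rewrite mulrAC mulfV// mul1r.
  by apply: (Hr _ _ hr _).2; exact: le_lt_trans ch kr.
have E : (fun h : R => h^-1 *: (((fun h : R => f (p + h *: v + k h *: w)) \o shift 0) (h *: 1)
    - f (p + 0 *: v + k 0 *: w))) =
   (fun h => h^-1 *: ((f \o shift p) (h *: v) - f p)) \+
   ((fun h => h^-1 *: ((k \o shift 0) (h *: 1) - k 0)) \* D).
  apply/funext => h /=.
  rewrite /D [_ *: 1]mulr1 !addr0 k0 !scale0r !addr0 subr0 (addrC _ p).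
  have [kh0|kh0] := eqVneq (k h) 0.
    by rewrite kh0 scale0r scaler0 mul0r !addr0.
  rewrite [_ *: (k h)]/(_ * _) -[_ * _ * (_ / _)]mulrA (mulrCA (k h)) mulfV// mulr1.
  by rewrite [X in X = _]mulrBr [X in _ = X + _]mulrBr mulrBr; ring.
have L : (fun h : R => h^-1 *: (((fun h : R => f (p + h *: v + k h *: w)) \o shift 0) (h *: 1)
    - f (p + 0 *: v + k 0 *: w))) @ 0^' --> 'D_v f p + k' * 'D_w f p.
  rewrite E; apply: cvgD; first exact: dv.
  apply: cvgM => //.
  by case: dk => dk <-; exact: dk.
apply: DeriveDef; first by apply/cvg_ex; exists ('D_v f p + k' * 'D_w f p).
exact: cvg_lim L.
Unshelve. all: by end_near. Qed.

(** The mean value theorem is applied along [v] to the increment [q |-> f (q + h *: w) - f q], then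
    along [w] to ['D_v f]. *)
Lemma second_difference f p v w (h : R) : 0 < h ->
  (forall s t, `|s| <= h -> `|t| <= h ->
    derivable f (p + s *: v + t *: w) v /\
    derivable ('D_v f) (p + s *: v + t *: w) w) ->
  exists c d, [/\ `|c| <= h, `|d| <= h &
    f (p + h *: v + h *: w) - f (p + h *: v) - (f (p + h *: w) - f p)
    = h * (h * 'D_w ('D_v f) (p + c *: v + d *: w))].
Proof.
move=> h0 H; have hh : `|h| = h by rewrite gtr0_norm.
have n0 : `|0 : R| <= h by rewrite normr0 ltW.
pose F q := f (q + h *: w) - f q.
have dF s : `|s| <= `|h| -> is_derive (p + s *: v) v F
    ('D_v f (p + s *: v + h *: w) - 'D_v f (p + s *: v)).
  rewrite hh => sh.
  have [d1 _] := H s h sh ltac:(by rewrite hh).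
  have [d2 _] := H _ 0 sh n0; rewrite scale0r addr0 in d2.
  have d3 : is_derive (p + s *: v) v (fun q => f (q + h *: w))
      ('D_v f (p + s *: v + h *: w)).
    have E : (fun r : R => r^-1 *: (((fun q => f (q + h *: w)) \o shift (p + s *: v)) (r *: v)
        - f (p + s *: v + h *: w))) =
      (fun r : R => r^-1 *: ((f \o shift (p + s *: v + h *: w)) (r *: v)
        - f (p + s *: v + h *: w))).
      by apply/funext => r /=; rewrite -!addrA.
    by apply: DeriveDef; [rewrite /derivable E; exact: d1|rewrite /derive E].
  exact: is_deriveB d3 (DeriveDef d2 erefl).
have [|c ch e1] := @mvt_line F p v h; first by move=> s /dF[].
have [|d dh e2] := @mvt_line ('D_v f) (p + c *: v) w h.
  by rewrite hh => s sh; rewrite hh in ch; exact: (H _ _ ch sh).2.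
rewrite hh in ch dh.
exists c, d; split=> //.
rewrite -e2; have [_ <-] := dF c ltac:(by rewrite hh).
by rewrite -e1 /F (addrAC p).
Qed.

(** The second difference is symmetric in [v] and [w], so the two mixed derivatives agree at two
    points close to [p], and continuity brings the equality to [p]. *)
Lemma derive_swap f p v w :
  (\forall q \near p, [/\ derivable f q v, derivable f q w,
     derivable ('D_v f) q w & derivable ('D_w f) q v]) ->
  {for p, continuous ('D_w ('D_v f))} -> {for p, continuous ('D_v ('D_w f))} ->
  'D_w ('D_v f) p = 'D_v ('D_w f) p.
Proof.
move=> nd cwv cvw; apply/eqP; rewrite -subr_eq0 -normr_le0.
apply/ler_addgt0Pr => e e0; rewrite add0r.
have e20 : 0 < e / 2 by rewrite divr_gt0.
have [r r0 Hr] := near_plane v w (filterI nd (filterI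
   ((cvgrPdist_lt _ _).1 cwv _ e20) ((cvgrPdist_lt _ _).1 cvw _ e20))).
have h0 : 0 < r / 2 by rewrite divr_gt0.
have hr : r / 2 < r by rewrite ltr_pdivrMr// ltr_pMr// ltr1n.
have [|c [d [ch dh e1]]] := @second_difference f p v w (r / 2) h0.
  move=> s t sh th; have [[d1 _ d2 _] _] := Hr s t (le_lt_trans sh hr) (le_lt_trans th hr).
  exact: conj d1 d2.
have [|c' [d' [ch' dh' e2]]] := @second_difference f p w v (r / 2) h0.
  move=> s t sh th; rewrite addrAC.
  have [[_ d1 _ d2] _] := Hr t s (le_lt_trans th hr) (le_lt_trans sh hr).
  exact: conj d1 d2.
have sub4 (x1 x2 x3 x4 : R) : x1 - x2 - (x3 - x4) = x1 - x3 - (x2 - x4) by ring.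
have [_ [h1 _]] := Hr c d (le_lt_trans ch hr) (le_lt_trans dh hr).
have [_ [_ h2]] := Hr d' c' (le_lt_trans dh' hr) (le_lt_trans ch' hr).
have pE : p + c' *: w + d' *: v = p + d' *: v + c' *: w by rewrite addrAC.
rewrite (addrAC p) sub4 e1 pE in e2.
have {}e2 := mulfI (lt0r_neq0 h0) (mulfI (lt0r_neq0 h0) e2).
rewrite -e2 in h2.
exact: ltW (distr_lt_half h1 h2).
Qed.

End DirectionalCalculus.

Section ContinuouslyDifferentiable.
Variables (R : realType) (V : normedModType R).
Implicit Types (f g : V -> R) (p v w : V) (O : set V).

(** Continuity of [f] is required separately: in a general normed space a discontinuous linear
    functional has constant directional derivatives. *)
Definition C1_on O f := forall p, O p ->
  [/\ {for p, continuous f}, forall v, derivable f p v &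
      forall v, {for p, continuous ('D_v f)}].

Lemma Ck_on_C1 k O f : Ck_on k.+1 O f -> C1_on O f.
Proof.
move=> H p Op; split; first by have [] := H [::] isT p Op.
  by move=> v; have [_ /(_ isT)] := H [::] isT p Op; apply.
by move=> v; have [] := H [:: v] isT p Op.
Qed.

Lemma Ck_on_derive k O f v : Ck_on k.+1 O f -> Ck_on k O ('D_v f).
Proof.
move=> H vs svs p Op.
have -> : iter_deriv vs ('D_v f) = iter_deriv (rcons vs v) f.
  by rewrite /iter_deriv foldr_rcons.
by have := H (rcons vs v); rewrite size_rcons !ltnS => /(_ svs p Op).
Qed.

Lemma Ck_onW j k O f : (j <= k)%N -> Ck_on k O f -> Ck_on j O f.
Proof.
move=> jk H vs svs p Op; have [c d] := H vs (leq_trans svs jk) p Op.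
by split=> // sj; apply: d; exact: leq_trans sj jk.
Qed.

Lemma Ck_onS k O O' f : O' `<=` O -> Ck_on k O f -> Ck_on k O' f.
Proof. by move=> OO H vs svs p /OO; exact: H. Qed.

Lemma C1_onS O O' f : O' `<=` O -> C1_on O f -> C1_on O' f.
Proof. by move=> OO H p /OO; exact: H. Qed.

Lemma C1_is_derive O f p v : C1_on O f -> O p -> is_derive p v f ('D_v f p).
Proof. by move=> H /H[_ d _]; exact: DeriveDef. Qed.

Lemma C1_on_cst O (c : R) : C1_on O (cst c).
Proof.
move=> p Op; split; first exact: cst_continuous.
  by move=> v; exact: derivable_cst.
move=> v; rewrite (_ : 'D_v (cst c) = cst 0); first exact: cst_continuous.
by apply/funext => q; rewrite derive_cst.
Qed.

Lemma continuous_near_eq f g p : (\forall q \near p, f q = g q) ->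
  {for p, continuous f} -> {for p, continuous g}.
Proof.
move=> fg cf; rewrite /prop_for/continuous_at -(nbhs_singleton fg).
apply: cvg_trans cf; apply: near_eq_cvg.
by move: fg; apply: filterS => q ->.
Qed.

Lemma C1_onD O f g : open O -> C1_on O f -> C1_on O g -> C1_on O (f + g).
Proof.
move=> oO Hf Hg p Op; have [cf df cdf] := Hf p Op; have [cg dg cdg] := Hg p Op.
split; first exact: continuousD.
  by move=> v; exact: derivableD.
move=> v; apply: (@continuous_near_eq ('D_v f + 'D_v g)).
  near=> q; have Oq : O q by near: q; exact: open_nbhs_nbhs.
  by rewrite deriveD//; [case: (Hf q Oq)|case: (Hg q Oq)].
by apply: continuousD; [exact: cdf|exact: cdg].
Unshelve. all: by end_near. Qed.

Lemma C1_onM O f g : open O -> C1_on O f -> C1_on O g -> C1_on O (f * g).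
Proof.
move=> oO Hf Hg p Op; have [cf df cdf] := Hf p Op; have [cg dg cdg] := Hg p Op.
split; first exact: continuousM.
  by move=> v; exact: derivableM.
move=> v; apply: (@continuous_near_eq (f * 'D_v g + g * 'D_v f)).
  near=> q; have Oq : O q by near: q; exact: open_nbhs_nbhs.
  by rewrite deriveM//; [case: (Hf q Oq)|case: (Hg q Oq)].
by apply: continuousD; apply: continuousM => //.
Unshelve. all: by end_near. Qed.

Lemma C1_onZ O (c : R) f : open O -> C1_on O f -> C1_on O (c \*o f).
Proof. by move=> oO Hf; apply: (C1_onM oO (@C1_on_cst O c) Hf). Qed.

Lemma Ck_on_swap O f p v w : open O -> Ck_on 2 O f -> O p ->
  'D_w ('D_v f) p = 'D_v ('D_w f) p.
Proof.
move=> oO H Op.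
have c1 q x : O q -> derivable f q x by move=> Oq; have [] := Ck_on_C1 H Oq.
have c2 q x y : O q -> derivable ('D_x f) q y /\ {for q, continuous ('D_y ('D_x f))}.
  by move=> Oq; have [_ d c] := Ck_on_C1 (@Ck_on_derive _ _ _ x H) Oq.
apply: derive_swap; [|exact: (c2 _ _ _ Op).2..].
near=> q; have Oq : O q by near: q; exact: open_nbhs_nbhs.
by split; [exact: c1..|exact: (c2 _ _ _ Oq).1|exact: (c2 _ _ _ Oq).1].
Unshelve. all: by end_near. Qed.

End ContinuouslyDifferentiable.

(** * Integration over the plane and the bulk *)

Section MeasurableBasis.

(** Second countability with a base of measurable sets. The neighbourhoods [N] are a parameter so
    that the notion passes to products, whose sigma-algebra is generated by rectangles and not by
    open sets. *)
Definition measurable_basis d (T : measurableType d) (N : T -> set_system T) :=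
  exists2 B : nat -> set T, forall n, measurable (B n) &
    forall x U, N x U -> exists2 n, B n x & B n `<=` U.

Lemma measurable_basis_prod d1 d2 (T1 : measurableType d1)
    (T2 : measurableType d2) (N1 : T1 -> set_system T1)
    (N2 : T2 -> set_system T2) :
  measurable_basis N1 -> measurable_basis N2 ->
  measurable_basis (fun x : T1 * T2 => filter_prod (N1 x.1) (N2 x.2)).
Proof.
move=> [B1 mB1 HB1] [B2 mB2 HB2].
(* Pairs of indices are encoded as naturals; a natural that encodes no pair gets the empty set,
   which does no harm in a base. *)
pose B n := if unpickle n is Some ij then B1 ij.1 `*` B2 ij.2 else set0.
exists B => [n|[x y] U /= [[A1 A2] /= [HA1 HA2] sub]].
  by rewrite /B; case: unpickle => [[i j]|]//; exact: measurableX.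
have [i B1x B1A] := HB1 _ _ HA1; have [j B2y B2A] := HB2 _ _ HA2.
exists (pickle (i, j)); rewrite /B pickleK// => -[u v] [/= /B1A ? /B2A ?].
exact: sub.
Qed.

Lemma measurable_basisR (R : realType) :
  measurable_basis (fun x : measurableTypeR R => @nbhs R R x).
Proof.
pose B n := if unpickle n is Some ab then
  `](ratr ab.1 : R), (ratr ab.2 : R)[%classic else set0.
exists B => [n|x U /nbhs_ballP[e /= e0 He]].
  by rewrite /B; case: unpickle => [[i j]|]//; exact: measurable_itv.
have [q /itvP qx] := @rat_in_itvoo R (x - e) x ltac:(by rewrite ltrBlDr ltrDl).
have [q' /itvP q'x] := @rat_in_itvoo R x (x + e) ltac:(by rewrite ltrDl).
exists (pickle (q, q')); rewrite /B pickleK/=; first by rewrite in_itv/= qx q'x.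
move=> y; rewrite /= in_itv/= => /andP[qy yq]; apply: He.
rewrite /ball/= ltr_norml; apply/andP; split.
  by rewrite ltrBrDl ltrBlDr; apply: lt_trans yq _; rewrite q'x.
by rewrite ltrBlDr -ltrBlDl; apply: lt_trans qy; rewrite qx.
Qed.

(** An open set is the countable union of the base sets that it contains. *)
Lemma measurable_basis_open d (T : measurableType d) (N : T -> set_system T)
    (A : set T) :
  measurable_basis N -> (forall x, A x -> N x A) -> measurable A.
Proof.
move=> [B mB HB] oA.
rewrite (_ : A = \bigcup_n if `[< B n `<=` A >] then B n else set0).
  by apply: bigcupT_measurable => n; case: ifP.
apply/seteqP; split => [x Ax|x [n _]]; last by case: asboolP => // H /H.
by have [n Bx BA] := HB _ _ (oA _ Ax); exists n => //; case: asboolP.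
Qed.

Lemma measurable_basis_fun (R : realType) d (T : measurableType d)
    (N : T -> set_system T) (f : T -> R) :
  measurable_basis N ->
  (forall x A, nbhs (f x) A -> N x (f @^-1` A)) ->
  measurable_fun setT f.
Proof.
move=> bN cf; apply: (measurability _ (RGenOpens.measurableE R)).
move=> _ [_ [a [b ->] <-]]; rewrite setTI.
apply: (measurable_basis_open bN) => x fx; apply/cf/open_nbhs_nbhs; split=> //.
Qed.

Lemma open_measurable3 (R : realType) (A : set (R * R * R)) : open A ->
  measurable (A : set (measurableTypeR R * measurableTypeR R * measurableTypeR R)).
Proof.
move=> oA; apply: (measurable_basis_open
  (measurable_basis_prod (measurable_basis_prod (@measurable_basisR R)
    (@measurable_basisR R)) (@measurable_basisR R))).
by move=> [[x y] z] Ax; exact: (open_nbhs_nbhs (conj oA Ax)).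
Qed.

Lemma continuous_measurable2 (R : realType) (f : R * R -> R) : continuous f ->
  measurable_fun [set: measurableTypeR R * measurableTypeR R] f.
Proof.
move=> cf; apply: (measurable_basis_fun
  (measurable_basis_prod (@measurable_basisR R) (@measurable_basisR R))).
by move=> [x y] A; exact: cf.
Qed.

Lemma continuous_measurable3 (R : realType) (f : R * R * R -> R) : continuous f ->
  measurable_fun [set: measurableTypeR R * measurableTypeR R * measurableTypeR R] f.
Proof.
move=> cf; apply: (measurable_basis_fun
  (measurable_basis_prod (measurable_basis_prod (@measurable_basisR R)
    (@measurable_basisR R)) (@measurable_basisR R))).
by move=> [[x y] z] A; exact: cf.
Qed.

End MeasurableBasis.

Section ProductIntegrals.

(** By Tonelli: the inner integral of the absolute value is [|f x|] times the finite integral of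
    [|g|]. *)
Lemma integrable_tensor d1 d2 (T1 : measurableType d1) (T2 : measurableType d2)
    (R : realType) (m1 : {sigma_finite_measure set T1 -> \bar R})
    (m2 : {sigma_finite_measure set T2 -> \bar R}) (f : T1 -> R) (g : T2 -> R) :
  m1.-integrable setT (EFin \o f) -> m2.-integrable setT (EFin \o g) ->
  (m1 \x m2)%E.-integrable setT (EFin \o (fun p => f p.1 * g p.2)).
Proof.
move=> intf intg.
have mf : measurable_fun setT f by case/integrableP: intf => /measurable_EFinP.
have mg : measurable_fun setT g by case/integrableP: intg => /measurable_EFinP.
apply/integrable12ltyP.
  apply/measurable_EFinP/measurable_funM.
    by apply: measurableT_comp => //.
  by apply: measurableT_comp => //.
have [_ If] := integrableP _ _ _ intf.
have [_ Ig] := integrableP _ _ _ intg.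
set c := (\int[m2]_y `|(g y)%:E|)%E in Ig.
have c0 : (0 <= c)%E by exact: integral_ge0.
rewrite (_ : (fun x => _) = (fun x => c * `|(f x)%:E|))%E.
  rewrite ge0_integralZl//.
    rewrite lte_mul_pinfty// ?ge0_fin_numE//; exact: integral_ge0.
  by apply: measurableT_comp => //; exact/measurable_EFinP.
apply/funext => x; rewrite muleC -ge0_integralZl//.
  by apply: eq_integral => y _ /=; rewrite normrM EFinM.
by apply: measurableT_comp => //; exact/measurable_EFinP.
Qed.

Section RealFubini.
Context d1 d2 (T1 : measurableType d1) (T2 : measurableType d2) (R : realType).
Variables (m1 : {sigma_finite_measure set T1 -> \bar R})
  (m2 : {sigma_finite_measure set T2 -> \bar R}) (h : T1 * T2 -> R).
Hypothesis int_h : (m1 \x m2)%E.-integrable setT (EFin \o h).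

Lemma EFin_Rintegral1 :
  (forall x, m2.-integrable setT (fun y => (h (x, y))%:E)) ->
  (fun x => (\int[m2]_y h (x, y))%:E) = fubini_F m2 (EFin \o h).
Proof.
move=> H; apply/funext => x; rewrite /Rintegral fineK//.
exact: (integrable_fin_num _ (H x)).
Qed.

(** Integrability is asked of every section, not of almost every one, so that the real-valued inner
    integral agrees with the extended one everywhere. The decay bounds provide it. *)
Lemma Rintegral12 : (forall x, m2.-integrable setT (fun y => (h (x, y))%:E)) ->
  m1.-integrable setT (EFin \o (fun x => \int[m2]_y h (x, y))) /\
  \int[(m1 \x m2)%E]_z h z = \int[m1]_x \int[m2]_y h (x, y).
Proof.
move=> H; rewrite /comp EFin_Rintegral1//.
split; first exact: integrable_fubini_F.
by rewrite [RHS]/Rintegral EFin_Rintegral1// integral12_prod_meas1.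
Qed.

Lemma Rintegral21 : (forall y, m1.-integrable setT (fun x => (h (x, y))%:E)) ->
  \int[(m1 \x m2)%E]_z h z = \int[m2]_y \int[m1]_x h (x, y).
Proof.
move=> H; rewrite /Rintegral -integral21_prod_meas1//; congr fine.
apply: eq_integral => y _; rewrite /Rintegral fineK//.
exact: (integrable_fin_num _ (H y)).
Qed.

End RealFubini.
End ProductIntegrals.

Section PlaneMeasure.
Variable R : realType.
Local Notation leb := (@lebesgue_measure R).
Local Notation leb2 := (@lebesgue_measure R \x @lebesgue_measure R)%E.

(** Squares of an increasing exhaustion of the line by sets of finite measure exhaust the plane. *)
Lemma sigma_finite_leb2 : sigma_finite setT leb2.
Proof.
have /sigma_finiteP[F [TF ndF Foo]] := sigma_finiteT leb.
exists (fun n => F n `*` F n).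
  apply/esym/seteqP; split => // -[x y] _.
  have [n _ Fx] : (\bigcup_n F n) x by rewrite -TF.
  have [k _ Fy] : (\bigcup_n F n) y by rewrite -TF.
  exists (maxn n k) => //; split => /=.
    by move: Fx; apply/subsetPset/ndF/leq_maxl.
  by move: Fy; apply/subsetPset/ndF/leq_maxr.
move=> k; have [mF Fk] := Foo k; split; first exact: measurableX.
by rewrite product_measure1E// lte_mul_pinfty// ge0_fin_numE.
Qed.

(* The library's sigma-finite structure on products is shadowed by the one for
   sub-probabilities, hence this alias. *)
Definition plane_measure :
  set (measurableTypeR R * measurableTypeR R) -> \bar R := leb2.
HB.instance Definition _ := Measure.copy plane_measure leb2.
HB.instance Definition _ :=
  Measure_isSigmaFinite.Build _ _ _ plane_measure sigma_finite_leb2.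

End PlaneMeasure.

Section WeightedIntegrals.
Variable R : realType.
Local Notation leb := (@lebesgue_measure R).
Local Notation leb2 := (@lebesgue_measure R \x @lebesgue_measure R)%E.
Local Notation leb3 :=
  ((@lebesgue_measure R \x @lebesgue_measure R) \x @lebesgue_measure R)%E.

Definition decay (x : R) : R := (oneDsqr x)^-1.
(* Integrable on the plane, and an upper bound for the square of
   1 / (1 + |X|^2), the rate at which the wave decays. *)
Definition decay2 (X : R * R) : R := decay X.1 * decay X.2.

Lemma decay_ge0 x : 0 <= decay x.
Proof. by rewrite invr_ge0. Qed.

Lemma continuous_decay : continuous decay.
Proof. by move=> x; apply: continuous_oneDsqrV. Qed.

Lemma decay2_ge0 X : 0 <= decay2 X.
Proof. by rewrite mulr_ge0// decay_ge0. Qed.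

Lemma integrable_dominated d (T : measurableType d)
    (m : {measure set T -> \bar R}) (f g : T -> R) :
  measurable_fun setT f -> (forall x, `|f x| <= g x) ->
  m.-integrable setT (EFin \o g) -> m.-integrable setT (EFin \o f).
Proof.
move=> mf fg; apply: le_integrable => //; first exact/measurable_EFinP.
by move=> x _ /=; rewrite lee_fin (le_trans (fg x))// ler_norm.
Qed.

Lemma integrable_decay : leb.-integrable setT (EFin \o decay).
Proof.
have md := continuous_measurable_fun continuous_decay.
apply/integrableP; split; first exact/measurable_EFinP.
under eq_integral => x _ do rewrite /= ger0_norm ?decay_ge0//.
rewrite ge0_symfun_integralT.
- by rewrite -set_itvcy integral0y_oneDsqr ltry.
- exact: decay_ge0.
- exact: continuous_decay.
- by move=> x; rewrite /decay/= /oneDsqr sqrrN.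
Qed.

Lemma integrable_decay2 : leb2.-integrable setT (EFin \o decay2).
Proof. exact: (integrable_tensor integrable_decay integrable_decay). Qed.

Lemma integrable_scaled d (T : measurableType d)
    (m : {measure set T -> \bar R}) (M : R) (f : T -> R) :
  m.-integrable setT (EFin \o f) -> m.-integrable setT (EFin \o (fun x => M * f x)).
Proof. by move=> intf; exact: (integrableZl measurableT M intf). Qed.

Lemma integrable_plane (f : R * R -> R) (M : R) : continuous f ->
  (forall X, `|f X| <= M * decay2 X) -> leb2.-integrable setT (EFin \o f).
Proof.
move=> cf fM; 
apply: (@integrable_dominated _ (measurableTypeR R * measurableTypeR R)%type
  leb2 f (fun X => M * decay2 X)) => //; first exact: continuous_measurable2.
exact: integrable_scaled integrable_decay2.
Qed.

Lemma integrable_line (f : R -> R) (M : R) : continuous f ->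
  (forall x, `|f x| <= M * decay x) -> leb.-integrable setT (EFin \o f).
Proof.
move=> cf fM; 
apply: (@integrable_dominated _ (measurableTypeR R) leb f (fun x => M * decay x)) => //.
  exact: continuous_measurable_fun.
exact: integrable_scaled integrable_decay.
Qed.

Lemma decay_cvg0 : decay n%:R @[n --> \oo] --> 0.
Proof.
apply/cvgr0Pnorm_lt => e e0; near=> n.
rewrite ger0_norm ?decay_ge0// /decay.
rewrite invf_plt; [|by rewrite posrE (lt_le_trans ltr01)|by rewrite posrE].
have n1 : e^-1 < n%:R by near: n; exact: nbhs_infty_gtr.
apply: lt_le_trans n1 _; rewrite /oneDsqr.
have [->|n0] := posnP n; first by rewrite expr0n addr0 ler01.
by rewrite (@le_trans _ _ (n%:R ^+ 2))// ?lerDr// expr2 ler_peMl// ler1n.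
Unshelve. all: by end_near. Qed.

(** By dominated convergence the integral is the limit of those over [[-n, n]], which are
    [F n - F (-n)] and vanish in the limit because [F] decays. *)
Lemma Rintegral_line_derive0 (F f : R -> R) (M : R) : continuous f ->
  (forall x : R, is_derive x 1 F (f x)) ->
  (forall x, `|F x| <= M * decay x) -> (forall x, `|f x| <= M * decay x) ->
  \int[leb]_x f x = 0.
Proof.
move=> cf dF FM fM.
have intf := integrable_line cf fM.
pose f_ (n : nat) := (EFin \o f) \_ `[- n%:R, n%:R].
have mf : measurable_fun setT (EFin \o f) by case/integrableP: intf.
have L : (\int[leb]_x f_ n x)%E @[n --> \oo] --> (\int[leb]_x (f x)%:E)%E.
  apply: (@dominated_cvg _ _ _ leb setT measurableT f_ _ (fun x => `|(f x)%:E|%E)) => //.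
  - by move=> n; apply/(measurable_restrictT _ _).1 => //; exact: measurable_funTS.
  - move=> x _; apply: cvg_near_cst; near=> n.
    rewrite /f_ patchE mem_set//= in_itv/= -ler_norml.
    by near: n; exact: nbhs_infty_ger.
  - exact: integrable_abse.
  - move=> n x _; rewrite /f_ patchE; case: ifP => _ //.
    by rewrite [X in (X <= _)%E]abse0 abse_ge0.
(* The index is shifted because the fundamental theorem of calculus needs a nondegenerate interval,
   and [[-0, 0]] is a point. *)
have E n : (\int[leb]_x f_ n.+1 x)%E = (F n.+1%:R - F (- n.+1%:R))%:E.
  rewrite -integral_mkcond; apply: continuous_FTC2.
  - by rewrite gtrN.
  - exact: continuous_subspaceT.
  - have cF : continuous F.
      move=> x; apply/differentiable_continuous/derivable1_diffP.
      by case: (dF x).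
    split; first by move=> x _; case: (dF x).
      by apply: cvg_at_right_filter; exact: cF.
    by apply: cvg_at_left_filter; exact: cF.
  - by move=> x _; rewrite derive1E; have [_ ->] := dF x.
have Z : (F n%:R - F (- n%:R)) @[n --> \oo] --> 0.
  rewrite -[X in _ --> X]subr0.
  have H (s : nat -> R) : (forall n, decay (s n) = decay n%:R) ->
      F (s n) @[n --> \oo] --> 0.
    move=> sE; apply/cvgr0Pnorm_le => e e0; near=> n.
    apply: (le_trans (FM _)); rewrite sE.
    rewrite (le_trans (ler_norm _))// normrM.
    (* [M] has no sign and may be 0, whereas [|M| + 1] can be divided by. *)
    have M0 : 0 < `|M| + 1 by rewrite ltr_wpDl.
    rewrite (@le_trans _ _ ((`|M| + 1) * `|decay n%:R|))//.
      by rewrite ler_wpM2r// lerDl.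
    rewrite -ler_pdivlMl//; near: n.
    have := cvgr0_norm_le _ decay_cvg0; apply.
    by rewrite mulrC divr_gt0.
  apply: cvgB; first exact: H.
  by apply: H => n; rewrite /decay/oneDsqr sqrrN.
rewrite /Rintegral.
have : (\int[leb]_x f_ n.+1 x)%E @[n --> \oo] --> (\int[leb]_x (f x)%:E)%E.
  by rewrite (cvg_shiftS (fun n => (\int[leb]_x f_ n x)%E)).
under eq_fun do rewrite E.
move=> L'; rewrite (_ : (\int[leb]_x (f x)%:E)%E = 0%E)//.
have Z' : (F n.+1%:R - F (- n.+1%:R))%:E @[n --> \oo] --> 0%E.
  apply: cvg_EFin; first exact: nearW.
  by rewrite (cvg_shiftS (fun n => F n%:R - F (- n%:R))).
exact: cvg_unique L' Z'.
Unshelve. all: by end_near. Qed.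

End WeightedIntegrals.

Lemma continuous_pair (T U V : topologicalType) (f : T -> U) (g : T -> V) x :
  {for x, continuous f} -> {for x, continuous g} ->
  {for x, continuous (fun y => (f y, g y))}.
Proof. by move=> cf cg; exact: (cvg_pair cf cg). Qed.

Section PlaneAndBulk.
Variable R : realType.
Local Notation leb := (@lebesgue_measure R).
Local Notation leb2 := (@lebesgue_measure R \x @lebesgue_measure R)%E.
Local Notation leb3 :=
  ((@lebesgue_measure R \x @lebesgue_measure R) \x @lebesgue_measure R)%E.
Local Notation RR := (measurableTypeR R * measurableTypeR R)%type.

Lemma continuous_pairl (T U V : topologicalType) (y : U) (f : T * U -> V) :
  continuous f ->
  continuous (fun x => f (x, y)).
Proof.
move=> cf x; apply: continuous_comp; last exact: cf.
by apply: continuous_pair; [exact: cvg_id|exact: cvg_cst].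
Qed.

Lemma continuous_pairr (T U V : topologicalType) (x : T) (f : T * U -> V) :
  continuous f ->
  continuous (fun y => f (x, y)).
Proof.
move=> cf y; apply: continuous_comp; last exact: cf.
by apply: continuous_pair; [exact: cvg_cst|exact: cvg_id].
Qed.

(** The order of integration is chosen by [j] so that the inner integral runs along [ex R j]; on
    such a line [decay2] is a constant multiple of [decay], and the inner integral vanishes. *)
Lemma Rintegral_plane_derive0 (j : 'I_2) (F f : R * R -> R) (M : R) :
  continuous f -> (forall X, is_derive X (ex R j) F (f X)) ->
  (forall X, `|F X| <= M * decay2 X) -> (forall X, `|f X| <= M * decay2 X) ->
  \int[leb2]_X f X = 0.
Proof.
move=> cf dF FM fM; have intf := integrable_plane cf fM.
have dl (p : R * R) (s : R) : is_derive s 1 (fun h : R => F (p + h *: ex R j))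
    (f (p + s *: ex R j)).
  have [dFp <-] := dF (p + s *: ex R j); exact: is_derive_line.
have bl (x y : R) : M * decay2 (x, y) = (M * decay y) * decay x.
  by rewrite /decay2 /=; ring.
have br (x y : R) : M * decay2 (x, y) = (M * decay x) * decay y.
  by rewrite /decay2 /=; ring.
case: j dF dl => [[|[|//]] jlt] dF dl.
- rewrite (@Rintegral21 _ _ (measurableTypeR R) (measurableTypeR R) _ leb leb f intf); last first.
    move=> y; apply: (@integrable_line _ (fun x => f (x, y)) (M * decay y)).
      exact: continuous_pairl.
    by move=> x; rewrite -bl.
  rewrite (@eq_Rintegral _ _ _ _ _ (cst 0)); first by rewrite Rintegral_cst// mul0r.
  move=> y _; apply: (@Rintegral_line_derive0 _ (fun x => F (x, y)) _ (M * decay y)).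
  + exact: continuous_pairl.
  + move=> x; have := dl (0, y) x.
    have E (h : R) : (0, y) + h *: ex R (Ordinal jlt) = (h, y).
      by congr (_, _); rewrite /= ?add0r /GRing.scale/= ?mulr1 ?mulr0 ?addr0.
    by under eq_fun do rewrite E; rewrite E.
  + by move=> x; rewrite -bl.
  + by move=> x; rewrite -bl.
- have sec x : leb.-integrable setT (fun y => (f (x, y))%:E).
    apply: (@integrable_line _ (fun y => f (x, y)) (M * decay x)).
      exact: continuous_pairr.
    by move=> y; rewrite -br.
  have [_ ->] := @Rintegral12 _ _ (measurableTypeR R) (measurableTypeR R) _ leb leb f intf sec.
  rewrite (@eq_Rintegral _ _ _ _ _ (cst 0)); first by rewrite Rintegral_cst// mul0r.
  move=> x _; apply: (@Rintegral_line_derive0 _ (fun y => F (x, y)) _ (M * decay x)).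
  + exact: continuous_pairr.
  + move=> y; have := dl (x, 0) y.
    have E (h : R) : (x, 0) + h *: ex R (Ordinal jlt) = (x, h).
      by congr (_, _); rewrite /= ?add0r /GRing.scale/= ?mulr1 ?mulr0 ?addr0.
    by under eq_fun do rewrite E; rewrite E.
  + by move=> y; rewrite -br.
  + by move=> y; rewrite -br.
Qed.

Section BoundedDepth.
Variables (L M : R) (D : set (R * R * R)) (f : R * R * R -> R).
Hypothesis mD : measurable (D : set (RR * measurableTypeR R)).
Hypothesis DL : forall Y, D Y -> - L <= Y.2 <= 0.
Hypothesis cf : continuous f.
Hypothesis fM : forall Y, D Y -> `|f Y| <= M * decay2 Y.1.

Let h := f \_ D.
Let strip : set R := `[- L, 0]%classic.

Let mh : measurable_fun [set: RR * measurableTypeR R] h.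
Proof.
apply/(measurable_restrictT _ _).1 => //; apply: measurable_funTS.
exact: continuous_measurable3.
Qed.

(** The majorant is a tensor product of an integrable function on the plane and one on the line,
    which makes [h] and all its sections integrable. Off [D] the bound must be nonnegative, hence
    [|M|]. *)
Let hM Y : `|h Y| <= `|M| * (decay2 Y.1 * \1_strip Y.2).
Proof.
rewrite /h patchE; case: ifP => [/set_mem DY|_].
  rewrite indicE mem_set ?mulr1; last by rewrite /strip/= in_itv/=; exact: DL.
  by apply: le_trans (fM DY) _; rewrite ler_wpM2r ?decay2_ge0 ?ler_norm.
by rewrite normr0 mulr_ge0// mulr_ge0 ?decay2_ge0// indicE.
Qed.

Let int_strip : leb.-integrable setT (EFin \o \1_strip).
Proof. exact: (integrable_indic_itv (- L) 0 true false). Qed.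

Let int_h : leb3.-integrable setT (EFin \o h).
Proof.
apply: (@integrable_dominated _ _ (RR * measurableTypeR R)%type leb3 h _ mh hM).
apply: integrable_scaled.
have H := (@integrable_tensor _ _ RR (measurableTypeR R) _ (@plane_measure R) leb
  _ _ (integrable_decay2 R) int_strip).
exact H.
Qed.

Let int_h1 X : leb.-integrable setT (fun z => (h (X, z))%:E).
Proof.
apply: (@integrable_dominated _ _ (measurableTypeR R) leb (fun z => h (X, z))
  (fun z => `|M| * decay2 X * \1_strip z)).
- by apply: (measurableT_comp mh); exact: pair1_measurable.
- by move=> z; rewrite -mulrA; exact: hM.
- exact: integrable_scaled.
Qed.

Let int_h2 z : leb2.-integrable setT (fun X => (h (X, z))%:E).
Proof.
apply: (@integrable_dominated _ _ RR leb2 (fun X => h (X, z))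
  (fun X => `|M| * decay2 X)).
- by apply: (measurableT_comp mh); exact: pair2_measurable.
- move=> X; apply: le_trans (hM _) _; rewrite mulrA.
  apply: ler_piMr; first by rewrite mulr_ge0 ?decay2_ge0.
  by rewrite indicE; case: (_ \in _).
- exact: integrable_scaled (integrable_decay2 R).
Qed.

Let hE1 X : \int[leb]_z h (X, z) = \int[leb]_(z in [set z | D (X, z)]) f (X, z).
Proof.
rewrite [RHS]Rintegral_mkcond; apply: eq_Rintegral => z _.
by rewrite /h !patchE; congr (if _ then _ else _); apply/idP/idP; rewrite !inE.
Qed.

Let hE2 z : \int[leb2]_X h (X, z) = \int[leb2]_(X in [set X | D (X, z)]) f (X, z).
Proof.
rewrite [RHS]Rintegral_mkcond; apply: eq_Rintegral => X _.
by rewrite /h !patchE; congr (if _ then _ else _); apply/idP/idP; rewrite !inE.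
Qed.

Lemma Rintegral_bulk1 :
  \int[leb3]_(Y in D) f Y
    = \int[leb2]_X \int[leb]_(z in [set z | D (X, z)]) f (X, z).
Proof.
rewrite Rintegral_mkcond.
have [_ ->] := @Rintegral12 _ _ RR (measurableTypeR R) _ (@plane_measure R) leb h int_h int_h1.
by apply: eq_Rintegral => X _; rewrite hE1.
Qed.

Lemma integrable_bulk1 : leb2.-integrable setT
  (EFin \o (fun X => \int[leb]_(z in [set z | D (X, z)]) f (X, z))).
Proof.
have [+ _] := @Rintegral12 _ _ RR (measurableTypeR R) _ (@plane_measure R) leb h int_h int_h1.
by under eq_fun do rewrite hE1.
Qed.

(** With the height outermost, a horizontal derivative can be integrated over the plane at each
    fixed height; the other order serves integration in depth. *)
Lemma Rintegral_bulk2 :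
  \int[leb3]_(Y in D) f Y
    = \int[leb]_z \int[leb2]_(X in [set X | D (X, z)]) f (X, z).
Proof.
rewrite Rintegral_mkcond.
rewrite (@Rintegral21 _ _ RR (measurableTypeR R) _ (@plane_measure R) leb h int_h int_h2).
by apply: eq_Rintegral => z _; rewrite hE2.
Qed.

End BoundedDepth.
End PlaneAndBulk.

(** * The flux of a vector field through the surface *)

Section Directions.
Variable R : realType.

Lemma eb_hor (j : 'I_2) : eb R (hor j) = (es R j, 0).
Proof. by case: j => [[|[|//]] jlt]; congr (_, _); rewrite /es /=; congr (_, _). Qed.

Lemma eb_ver : eb R ver = (0, 1).
Proof. by []. Qed.

Lemma sum3E (V : zmodType) (f : 'I_3 -> V) :
  \sum_(i < 3) f i = \sum_(j < 2) f (hor j) + f ver.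
Proof.
rewrite big_ord_recr; congr (_ + _); apply: eq_bigr => j _; congr f.
by apply/val_inj; rewrite /= /bump leqNgt ltn_ord.
Qed.

Lemma shift_hor (t : R) (X : R * R) (z h : R) (j : 'I_2) :
  (t, X, z) + h *: eb R (hor j) = (t, X + h *: ex R j, z).
Proof.
rewrite eb_hor; congr (_, _); last by rewrite /= [_ *: _]mulr0 addr0.
by congr (_, _); rewrite /= [_ *: _]mulr0 addr0.
Qed.

Lemma shift_ver (q : R * (R * R)) (z h : R) :
  (q, z) + h *: eb R ver = (q, z + h).
Proof. by rewrite eb_ver; congr (_, _); rewrite /= ?scaler0 ?addr0// [_ *: _]mulr1. Qed.

Lemma is_derive_from_line (V : normedModType R) (f : V -> R) (p v : V) (d : R) :
  is_derive (0 : R) 1 (fun h : R => f (p + h *: v)) d -> is_derive p v f d.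
Proof.
have E : (fun h : R => h^-1 *: (((fun h : R => f (p + h *: v)) \o shift 0) (h *: 1)
    - f (p + 0 *: v))) =
   (fun h => h^-1 *: ((f \o shift p) (h *: v) - f p)).
  by apply/funext => h /=; rewrite scale0r !addr0 [h *: 1]mulr1 (addrC p).
move=> [d1 d2]; apply: DeriveDef.
  by move: d1; rewrite /derivable E.
by move: d2; rewrite /derive E.
Qed.

Lemma is_derive_add_line (V : normedModType R) (f : V -> R) (p v : V) (d : R) :
  is_derive p v f d -> is_derive (0 : R) 1 (fun h : R => f (p + h *: v)) d.
Proof.
move=> [df <-]; have := @is_derive_line R V f p v 0.
by rewrite scale0r addr0; apply.
Qed.

End Directions.

Section Slope.
Variables (R : realType) (O : set (R * (R * R) * R)) (G : R * (R * R) * R -> R).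
Hypotheses (oO : open O) (CG : C1_on O G).

(** Here [c] is the relative depth, held fixed. Moving [X] along [ex R j] moves the point both
    horizontally and, at speed [c * db], vertically, so the chain rule in two directions applies. *)
Lemma is_derive_slope (b : R * R -> R) (db t c : R) (X : R * R) (j : 'I_2) :
  O (t, X, c * b X) -> is_derive X (ex R j) b db ->
  is_derive X (ex R j) (fun X => G (t, X, c * b X))
    ('D_(eb R (hor j)) G (t, X, c * b X)
     + c * db * 'D_(eb R ver) G (t, X, c * b X)).
Proof.
move=> Op dbX; apply: is_derive_from_line.
have [_ dG cG] := CG Op.
have kd : is_derive (0 : R) 1 (fun h : R => c * b (X + h *: ex R j) - c * b X) (c * db).
  have H := @is_deriveZ R R R _ c 0 1 _ (is_derive_add_line dbX).
  have := @is_deriveB _ _ _ _ _ _ _ _ _ H (@is_derive_cst _ _ _ (c * b X) (0 : R) 1).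
  by move=> H'; apply: is_derive_eq H' _; rewrite subr0.
have := @is_derive_chain2 R _ G _ (eb R (hor j)) (eb R ver) _ _ (dG _) _ (cG _) _ kd.
rewrite scale0r addr0 subrr => /(_ _ erefl) H.
have nO : \forall q \near (t, X, c * b X), derivable G q (eb R ver).
  apply: filterS (open_nbhs_nbhs (conj oO Op)) => q Oq.
  by have [_ d _] := CG Oq; exact: d.
have {}H := H nO.
suff <- : (fun h : R => G ((t, X, c * b X) + h *: eb R (hor j) +
     (c * b (X + h *: ex R j) - c * b X) *: eb R ver)) =
   (fun h : R => G (t, X + h *: ex R j, c * b (X + h *: ex R j))) by [].
by apply/funext => h; rewrite shift_hor shift_ver subrKC.
Qed.

Lemma is_derive_depth (q : R * (R * R)) (b s : R) : O (q, s * b) ->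
  is_derive s 1 (fun s : R => G (q, s * b)) (b * 'D_(eb R ver) G (q, s * b)).
Proof.
move=> Op.
have [_ dG _] := CG Op.
have dm := is_derive_mulr b s.
have dl : is_derive (s * b) 1 (fun h : R => G ((q, 0) + h *: eb R ver))
    ('D_(eb R ver) G ((q, 0) + (s * b) *: eb R ver)).
  by apply: is_derive_line; rewrite shift_ver add0r; exact: dG.
have := is_derive1_comp (g := fun s : R => s * b) dl dm.
rewrite shift_ver add0r mulrC; suff -> : (fun h : R => G ((q, 0) + h *: eb R ver)) \o
  (fun s : R => s * b) = (fun s : R => G (q, s * b)) by [].
by apply/funext => h /=; rewrite shift_ver add0r.
Qed.

End Slope.

Section Clamp.
Variable R : realType.

Definition clamp (a s : R) : R := Num.max (- a) (Num.min s 0).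

Lemma clamp_in a s : 0 <= a -> - a <= clamp a s <= 0.
Proof.
by move=> a0; rewrite le_max lexx ge_max oppr_le0 a0 ge_min lexx orbT.
Qed.

Lemma clampE a s : - a <= s <= 0 -> clamp a s = s.
Proof. by move=> /andP[a0 s0]; rewrite /clamp min_l// max_r. Qed.

Lemma continuous_clamp (T : topologicalType) (a s : T -> R) x :
  {for x, continuous a} -> {for x, continuous s} ->
  {for x, continuous (fun y => clamp (a y) (s y))}.
Proof.
move=> ca cs.
have cm : {for x, continuous (s \min cst 0)}.
  by apply: continuous_min; [exact: cs|exact: cst_continuous].
have ca' : {for x, continuous (fun y => - a y)} by exact: continuousN.
exact: (continuous_max ca' cm).
Qed.

End Clamp.

Section Flattening.
Variables (R : realType) (b : R * R -> R) (db : 'I_2 -> R * R -> R) (L B : R).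
Hypothesis bL : forall X, 0 < b X <= L.
Hypothesis db_derive : forall X j, is_derive X (ex R j) b (db j X).
Hypothesis cb : continuous b.
Hypothesis cdb : forall j, continuous (db j).
Hypothesis dbB : forall X j, `|db j X| <= B.

Variables (t M : R) (O : set (R * (R * R) * R)) (F : 'I_3 -> R * (R * R) * R -> R).
Hypothesis oO : open O.
Hypothesis layerO : forall X z, - b X <= z <= 0 -> O (t, X, z).
Hypothesis CF : forall i, C1_on O (F i).
Hypothesis FM : forall i X z, - b X <= z <= 0 -> `|F i (t, X, z)| <= M * decay2 X.
Hypothesis dFM : forall i k X z, - b X <= z <= 0 ->
  `|'D_(eb R k) (F i) (t, X, z)| <= M * decay2 X.
Hypothesis F_bottom : forall X,
  F ver (t, X, - b X) + \sum_(j < 2) db j X * F (hor j) (t, X, - b X) = 0.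

Local Notation leb := (@lebesgue_measure R).
Local Notation leb2 := (@lebesgue_measure R \x @lebesgue_measure R)%E.
Local Notation leb3 :=
  ((@lebesgue_measure R \x @lebesgue_measure R) \x @lebesgue_measure R)%E.

Let depth (Y : R * R * R) : R := clamp 1 Y.2 * b Y.1.

Let depth_in Y : - b Y.1 <= depth Y <= 0.
Proof.
have /andP[c1 c0] := @clamp_in R 1 Y.2 ler01.
have /andP[b0 _] := bL Y.1.
by rewrite /depth -mulN1r ler_wpM2r ?(ltW b0)//= mulr_le0_ge0// ltW.
Qed.

(* The layer -b <= z <= 0 in the coordinates (X, s), z = s b(X); clamping s
   makes functions given on the layer continuous on the whole space. *)
Let flat (G : R * (R * R) * R -> R) (Y : R * R * R) : R := G (t, Y.1, depth Y).

Let continuous_bulk (G : R * (R * R) * R -> R) (d : R * R * R -> R) :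
  continuous d -> (forall Y, - b Y.1 <= d Y <= 0) ->
  (forall p, O p -> {for p, continuous G}) ->
  continuous (fun Y : R * R * R => G (t, Y.1, d Y)).
Proof.
move=> cd db_in cG Y.
have c : {for Y, continuous (fun Y : R * R * R => (t, Y.1, d Y))}.
  apply: continuous_pair; last exact: cd.
  by apply: continuous_pair; [exact: cst_continuous|exact: cvg_fst].
exact: (continuous_comp c (cG _ (layerO (db_in Y)))).
Qed.

Let cb1 : continuous (fun Y : R * R * R => b Y.1).
Proof. by move=> Y; apply: continuous_comp; [exact: cvg_fst|exact: cb]. Qed.

Let cdb1 j : continuous (fun Y : R * R * R => db j Y.1).
Proof. by move=> Y; apply: continuous_comp; [exact: cvg_fst|exact: cdb]. Qed.

Let cclamp : continuous (fun Y : R * R * R => clamp 1 Y.2).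
Proof. by move=> Y; apply: continuous_clamp; [exact: cst_continuous|exact: cvg_snd]. Qed.

Let continuous_depth : continuous depth.
Proof. by move=> Y; apply: cvgM; [exact: cclamp|exact: cb1]. Qed.

Let continuous_flat G : (forall p, O p -> {for p, continuous G}) ->
  continuous (flat G).
Proof. by move=> cG; exact: continuous_bulk continuous_depth depth_in cG. Qed.

Let cF i : continuous (flat (F i)).
Proof. by apply: continuous_flat => p /(@CF i)[]. Qed.

Let cdF i k : continuous (flat ('D_(eb R k) (F i))).
Proof. by apply: continuous_flat => p /(@CF i)[_ _]; exact. Qed.

(* Components of the divergence of the Piola transform of F under the change
   of variables z = s b(X). *)
Let Ah j Y := db j Y.1 * flat (F (hor j)) Y
  + b Y.1 * (flat ('D_(eb R (hor j)) (F (hor j))) Y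
             + clamp 1 Y.2 * db j Y.1 * flat ('D_(eb R ver) (F (hor j))) Y).
Let Av Y := b Y.1 * flat ('D_(eb R ver) (F ver)) Y
  - \sum_(j < 2) db j Y.1 * (flat (F (hor j)) Y
      + clamp 1 Y.2 * (b Y.1 * flat ('D_(eb R ver) (F (hor j))) Y)).

(** For [s] in [[-1, 0]], [Ah j] is the derivative along [X_j] of [b F_j], and [Av] is the
    derivative along [s] of [F_ver - sum_j s (d_j b) F_j], all taken at [z = s b(X)]. The terms with
    [d_j b] cancel in pairs and the Jacobian [b] remains. *)
Let AE Y : \sum_(j < 2) Ah j Y + Av Y = b Y.1 * flat (divergence F) Y.
Proof.
rewrite /Av /Ah /flat /divergence sum3E mulrDr mulr_sumr addrCA addrC -sumrB.
by congr (_ + _); apply: eq_bigr => j _; ring.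
Qed.

Let cAh j : continuous (Ah j).
Proof.
move=> Y; rewrite /continuous_at /Ah; apply: cvgD.
  by apply: cvgM; [exact: cdb1|exact: cF].
apply: cvgM; first exact: cb1.
apply: cvgD; first exact: cdF.
apply: cvgM; last exact: cdF.
by apply: cvgM; [exact: cclamp|exact: cdb1].
Qed.

Let cAv : continuous Av.
Proof.
move=> Y; rewrite /continuous_at /Av; apply: cvgB.
  by apply: cvgM; [exact: cb1|exact: cdF].
under eq_fun do rewrite big_ord_recl big_ord1.
rewrite big_ord_recl big_ord1.
apply: cvgD; (apply: cvgM; first exact: cdb1);
  (apply: cvgD; first exact: cF); (apply: cvgM; first exact: cclamp);
  by apply: cvgM; [exact: cb1|exact: cdF].
Qed.

Let nb X : `|b X| <= L.
Proof. by case/andP: (bL X) => b0 bL0; rewrite gtr0_norm. Qed.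

Let nclamp s : `|clamp 1 s : R| <= 1.
Proof.
have /andP[c1 c0] := @clamp_in R 1 s ler01.
by rewrite ler_norml c1 (le_trans c0).
Qed.

Let nM (x y a c : R) : `|x| <= a -> `|y| <= c -> `|x * y| <= a * c.
Proof. by move=> xa yc; rewrite normrM ler_pM. Qed.

Let nD (x y a c : R) : `|x| <= a -> `|y| <= c -> `|x + y| <= a + c.
Proof. by move=> xa yc; rewrite (le_trans (ler_normD _ _))// lerD. Qed.

Let nF i Y : `|flat (F i) Y| <= M * decay2 Y.1.
Proof. by apply: FM; exact: depth_in. Qed.

Let ndF i k Y : `|flat ('D_(eb R k) (F i)) Y| <= M * decay2 Y.1.
Proof. by apply: dFM; exact: depth_in. Qed.

(** Built factor by factor after the shape of [Ah]: [B] bounds the slope, [L] the depth, [M] the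
    field and its derivatives up to the weight, and the explicit 1 the clamped [s]. *)
Let N := B * M + L * (M + 1 * B * M).

Let nAh j Y : `|Ah j Y| <= N * decay2 Y.1.
Proof.
have -> : N * decay2 Y.1 = B * (M * decay2 Y.1)
   + L * (M * decay2 Y.1 + 1 * B * (M * decay2 Y.1)) by rewrite /N; ring.
apply: nD; first exact: nM.
apply: nM; first exact: nb.
by apply: nD; [exact: ndF|apply: nM; [apply: nM; [exact: nclamp|exact: dbB]|exact: ndF]].
Qed.

Let N' := L * M + (B * (M + 1 * (L * M)) + B * (M + 1 * (L * M))).

Let nAv Y : `|Av Y| <= N' * decay2 Y.1.
Proof.
have -> : N' * decay2 Y.1 = L * (M * decay2 Y.1)
   + (B * (M * decay2 Y.1 + 1 * (L * (M * decay2 Y.1))) +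
      B * (M * decay2 Y.1 + 1 * (L * (M * decay2 Y.1)))) by rewrite /N'; ring.
rewrite /Av big_ord_recl big_ord1.
apply: nD; first by apply: nM; [exact: nb|exact: ndF].
rewrite normrN; apply: nD; (apply: nM; first exact: dbB);
  (apply: nD; first exact: nF); (apply: nM; first exact: nclamp);
  by apply: nM; [exact: nb|exact: ndF].
Qed.

Let slab : set (R * R * R) := [set Y | -1 <= Y.2 <= 0].

Let mslab : measurable (slab : set (measurableTypeR R * measurableTypeR R * measurableTypeR R)).
Proof.
rewrite (_ : slab = setT `*` `[-1, 0]%classic).
  by apply: measurableX => //; exact: measurable_itv.
by apply/seteqP; split=> Y /=; rewrite in_itv//= => -[].
Qed.

Let slabE X : [set s | slab (X, s)] = `[-1, 0]%classic.
Proof. by apply/seteqP; split=> s /=; rewrite in_itv. Qed.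

Let integrable_slab (A : R * R * R -> R) (K : R) : continuous A ->
  (forall Y, `|A Y| <= K * decay2 Y.1) ->
  leb2.-integrable setT (EFin \o (fun X => \int[leb]_(s in `[-1, 0]) A (X, s))).
Proof.
move=> cA nA; have := @integrable_bulk1 R 1 K slab A mslab (fun _ => id) cA (fun Y _ => nA Y).
by under eq_fun do rewrite slabE.
Qed.

(** After exchanging the integrals, each slice at fixed [s] is the integral over the plane of a
    derivative along [X_j] of a decaying function. *)
Let slab_hor j : \int[leb2]_X \int[leb]_(s in `[-1, 0]) Ah j (X, s) = 0.
Proof.
have sE X : \int[leb]_(s in `[-1, 0]) Ah j (X, s)
    = \int[leb]_(s in [set s | slab (X, s)]) Ah j (X, s) by rewrite slabE.
under eq_Rintegral do rewrite sE.
rewrite -(@Rintegral_bulk1 R 1 N slab (Ah j) mslab (fun _ => id) (@cAh j) (fun Y _ => nAh j Y)).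
rewrite (@Rintegral_bulk2 R 1 N slab (Ah j) mslab (fun _ => id) (@cAh j) (fun Y _ => nAh j Y)).
rewrite (@eq_Rintegral _ _ _ _ _ (cst 0)); first by rewrite Rintegral_cst// mul0r.
move=> s _; have [sI|sI] := boolP (-1 <= s <= 0); last first.
  rewrite (_ : [set X | slab (X, s)] = set0) ?Rintegral_set0//.
  by apply/seteqP; split=> // X /= sX; rewrite /slab/= sX in sI.
rewrite (_ : [set X | slab (X, s)] = setT); last by apply/seteqP; split.
(* The primitive is [b F_j] at fixed relative depth. One constant has to bound both it, by [L * M],
   and its derivative, by [N]. *)
apply: (@Rintegral_plane_derive0 R j
  (fun X => b X * F (hor j) (t, X, clamp 1 s * b X)) _ (Num.max N (L * M))).
- exact: (continuous_pairl (@cAh j)).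
- move=> X; have Op : O (t, X, clamp 1 s * b X) by apply: layerO; exact: (depth_in (X, s)).
  have H := @is_deriveM _ _ _ _ _ _ _ _ (db_derive X j)
    (is_derive_slope oO (@CF (hor j)) Op (db_derive X j)).
  by apply: is_derive_eq H _; rewrite /Ah /flat/depth /= /GRing.scale /=; ring.
- move=> X; rewrite (@le_trans _ _ (L * (M * decay2 X)))//.
    by apply: nM; [exact: nb|exact: (nF (hor j) (X, s))].
  by rewrite mulrA ler_wpM2r ?decay2_ge0// le_max lexx orbT.
- by move=> X; rewrite (le_trans (nAh j (X, s)))// ler_wpM2r ?decay2_ge0// le_max lexx.
Qed.

Let slab_ver X : \int[leb]_(s in `[-1, 0]) Av (X, s) = F ver (t, X, 0).
Proof.
(* The vertical component of the Piola transform. At [s = 0] it is the surface value of [F ver]; at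
   [s = -1] it is the left side of [F_bottom], which expresses tangency since [(grad b, 1)] is
   normal to [z = -b]. *)
pose V s := F ver (t, X, s * b X) - \sum_(j < 2) db j X * (s * F (hor j) (t, X, s * b X)).
have b0 : 0 <= b X by case/andP: (bL X) => /ltW.
have sO s : -1 <= s <= 0 -> O (t, X, s * b X).
  move=> /andP[s1 s0]; apply: layerO.
  by rewrite -mulN1r ler_wpM2r//= mulr_le0_ge0.
have dV (s : R) : -1 <= s <= 0 -> is_derive s 1 V (Av (X, s)).
  move=> sI; have Op := sO s sI.
  have d i := is_derive_depth (@CF i) Op.
  have dj (j : 'I_2) : is_derive s 1 (fun s => db j X * (s * F (hor j) (t, X, s * b X)))
     (db j X * (F (hor j) (t, X, s * b X)
        + s * (b X * 'D_(eb R ver) (F (hor j)) (t, X, s * b X)))).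
    have H := @is_deriveZ _ _ _ _ (db j X) _ _ _
      (@is_deriveM _ _ _ _ _ _ _ _ (is_derive_id s 1) (d (hor j))).
    by apply: is_derive_eq H _; rewrite /GRing.scale/=; ring.
  have VE : V = (fun s => F ver (t, X, s * b X)) -
     ((fun s => db ord0 X * (s * F (hor ord0) (t, X, s * b X)))
     + (fun s => db (lift ord0 ord0) X * (s * F (hor (lift ord0 ord0)) (t, X, s * b X)))).
    by apply/funext => r; rewrite /V big_ord_recl big_ord1.
  rewrite VE.
  have H := is_deriveB (d ver) (is_deriveD (dj ord0) (dj (lift ord0 ord0))).
  apply: is_derive_eq H _.
  by rewrite /Av /flat/depth/= clampE// big_ord_recl big_ord1.
have cV (s : R) : -1 <= s <= 0 -> {for s, continuous V}.
  by move=> /dV[d _]; apply/differentiable_continuous/derivable1_diffP.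
rewrite /Rintegral (@continuous_FTC2 R (fun s => Av (X, s)) V)//.
- have -> : V 0 = F ver (t, X, 0).
    by rewrite /V mul0r big1 ?subr0// => j _; rewrite mul0r mulr0.
  have -> : V (-1) = F ver (t, X, - b X) + \sum_(j < 2) db j X * F (hor j) (t, X, - b X).
    rewrite /V mulN1r; congr (_ + _); rewrite -sumrN; apply: eq_bigr => j _.
    by rewrite mulN1r mulrN opprK.
  by rewrite F_bottom sube0.
- by apply: continuous_subspaceT; exact: continuous_pairr cAv.
- split.
  + by move=> s /[!in_itv]/= /andP[s1 s0]; have [] := dV s ltac:(by rewrite !ltW).
  + apply: cvg_at_right_filter; apply: cV; by rewrite lexx lerN10.
  + apply: cvg_at_left_filter; apply: cV; by rewrite lexx lerN10.
- move=> s /[!in_itv]/= /andP[s1 s0]; rewrite derive1E.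
  by have [_ ->] := dV s ltac:(by rewrite !ltW).
Qed.

Let continuous_div p : O p -> {for p, continuous (divergence F)}.
Proof.
move=> Op; rewrite /prop_for/continuous_at /divergence.
apply: cvg_big => [|i _]; first exact: add_continuous.
by have [_ _] := @CF i p Op; exact.
Qed.

(** The physical height is clamped to [[-b, 0]] here, unlike in [depth], so that the integrand in
    the original coordinates is continuous on the whole space. *)
Let bulk_div (Y : R * R * R) : R := divergence F (t, Y.1, clamp (b Y.1) Y.2).

Let clamp_depth_in (Y : R * R * R) : - b Y.1 <= clamp (b Y.1) Y.2 <= 0.
Proof. by apply: clamp_in; case/andP: (bL Y.1) => /ltW. Qed.

Let cbulk_div : continuous bulk_div.
Proof.
apply: continuous_bulk clamp_depth_in continuous_div.
by move=> Y; apply: continuous_clamp; [exact: cb1|exact: cvg_snd].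
Qed.

Let nbulk_div Y : `|bulk_div Y| <= (M + M + M) * decay2 Y.1.
Proof.
rewrite /bulk_div /divergence !big_ord_recl big_ord0 addr0 !mulrDl -addrA.
by apply: nD; [|apply: nD]; apply: dFM; exact: clamp_depth_in.
Qed.

Let change_depth X :
  \int[leb]_(z in [set z | Omega b (X, z)]) bulk_div (X, z)
  = \int[leb]_(s in `[-1, 0]) (b X * flat (divergence F) (X, s)).
Proof.
have b0 : 0 < b X by case/andP: (bL X).
have -> : [set z | Omega b (X, z)] = `]- b X, 0[%classic.
  by apply/seteqP; split=> s /=; rewrite in_itv.
have intb : leb.-integrable `[- b X, 0] (EFin \o (fun z => bulk_div (X, z))).
  apply: continuous_compact_integrable; first exact: segment_compact.
  by apply: continuous_subspaceT; exact: continuous_pairr cbulk_div.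
(* The endpoints are added, at no cost for the integral, to reach the closed interval of the
   substitution rule. *)
rewrite Rintegral_itv_bndo_bndc; last first.
  apply: integrableS intb; [exact: measurable_itv|exact: measurable_itv|].
  exact: subset_itv_oo_cc.
rewrite Rintegral_itv_obnd_cbnd; last first.
  apply: integrableS intb; [exact: measurable_itv|exact: measurable_itv|].
  exact: subset_itv_oc_cc.
have dm := is_derive_mulr (b X).
have dmE : derive1 (fun s : R => s * b X) = cst (b X).
  by apply/funext => s; rewrite derive1E; have [_ ->] := dm s.
have cm : continuous (fun s : R => s * b X).
  by move=> s; have [d _] := dm s; apply/differentiable_continuous/derivable1_diffP.
have := @integration_by_substitution_increasing R (fun s => s * b X)
  (fun z => bulk_div (X, z)) (-1) 0 (lerN10 _).
rewrite mul0r mulN1r dmE /Rintegral => ->.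
- congr fine; apply: eq_integral => s /[!inE]/= /[!in_itv]/= sI.
  case/andP: sI => s1 s0.
  have d1 : clamp 1 s = s by apply: clampE; rewrite s1.
  have d2 : clamp (b X) (s * b X) = s * b X.
    by apply: clampE; rewrite -mulN1r ler_wpM2r ?(ltW b0)//= mulr_le0_ge0// ltW.
  congr EFin; rewrite [LHS]/(divergence F (t, X, clamp (b X) (s * b X)) * b X).
  by rewrite d2 [LHS]mulrC /flat/depth /= d1.
- by move=> x y _ _ xy; rewrite ltr_pM2r.
- by move=> s _; exact: cst_continuous.
- exact: is_cvg_cst.
- exact: is_cvg_cst.
- split; first by move=> s _; have [d _] := dm s.
  + by apply: cvg_at_right_filter; exact: cm.
  + by apply: cvg_at_left_filter; exact: cm.
- by apply: continuous_subspaceT; exact: continuous_pairr cbulk_div.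
Qed.

Let open_Omega : open (Omega b).
Proof.
have -> : Omega b = (fun Y => Y.2 + b Y.1) @^-1` `]0, +oo[%classic
    `&` (fun Y => Y.2) @^-1` `]-oo, 0[%classic.
  apply/seteqP; split=> Y /=; rewrite !in_itv/= ?andbT.
    by move=> /andP[Y1 Y2]; rewrite -ltrBlDr sub0r.
  by move=> [Y1 Y2]; rewrite /Omega /= Y2 andbT -subr_gt0 opprK.
apply: openI; apply: open_comp.
- by move=> Y _; apply: cvgD; [exact: cvg_snd|exact: cb1].
- exact: interval_open.
- by move=> Y _; exact: cvg_snd.
- exact: interval_open.
Qed.

Lemma flux_through_surface :
  \int[leb3]_(Y in Omega b) divergence F (t, Y.1, Y.2)
  = \int[leb2]_X F ver (t, X, 0).
Proof.
have -> : \int[leb3]_(Y in Omega b) divergence F (t, Y.1, Y.2)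
    = \int[leb3]_(Y in Omega b) bulk_div Y.
  apply: eq_Rintegral => Y /[!inE]/= /andP[Y1 Y2]; rewrite /bulk_div clampE//.
  by rewrite !ltW.
rewrite (@Rintegral_bulk1 R L (M + M + M) (Omega b) bulk_div).
- have -> : \int[leb2]_X \int[leb]_(z in [set z | Omega b (X, z)]) bulk_div (X, z)
    = \int[leb2]_X
    ((\int[leb]_(s in `[-1, 0]) Ah ord0 (X, s) +
     \int[leb]_(s in `[-1, 0]) Ah (lift ord0 ord0) (X, s))
    + F ver (t, X, 0)).
    apply: eq_Rintegral => X _; rewrite change_depth -slab_ver.
    have iA (A : R * R * R -> R) : continuous A ->
        leb.-integrable `[-1, 0] (EFin \o (fun s => A (X, s))).
      move=> cA; apply: continuous_compact_integrable; first exact: segment_compact.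
      by apply: continuous_subspaceT; exact: continuous_pairr cA.
    have mI := @measurable_itv R `[-1, 0].
    rewrite -RintegralD; [|exact: mI|exact: (iA _ (@cAh _))|exact: (iA _ (@cAh _))].
    have cAD : continuous (fun Y => Ah ord0 Y + Ah (lift ord0 ord0) Y).
      by move=> Y; apply: cvgD; exact: cAh.
    rewrite -RintegralD; [|exact: mI|exact: (iA _ cAD)|exact: (iA _ cAv)].
    apply: eq_Rintegral => s _; have E := AE (X, s).
    by rewrite big_ord_recl big_ord1 in E; exact: esym E.
  have i1 j := integrable_slab (@cAh j) (nAh j).
  have i2 := integrable_slab cAv nAv.
  (* The surface value of [F ver] is integrable because it equals the vertical integral of [Av]. *)
  have i3 : leb2.-integrable setT (EFin \o (fun X => F ver (t, X, 0))).
    by move: i2; under eq_fun do rewrite slab_ver.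
  have i4 := integrableD measurableT (i1 ord0) (i1 (lift ord0 ord0)).
  rewrite RintegralD; [|exact: measurableT|exact: i4|exact: i3].
  rewrite RintegralD; [|exact: measurableT|exact: i1|exact: i1].
  rewrite -[RHS]add0r -[X in _ = X + _]addr0.
  by congr (_ + _ + _); exact: slab_hor.
- exact: open_measurable3 open_Omega.
- move=> Y /andP[Y1 Y2]; rewrite (ltW Y2) andbT (le_trans _ (ltW Y1))//.
  by rewrite lerN2; case/andP: (bL Y.1).
- exact: cbulk_div.
- by move=> Y _; exact: nbulk_div.
Qed.

End Flattening.

(** * Traces on [z = 0], the slope of the bottom and the decay rates *)

Section Surface.
Variable R : realType.

Lemma trace0_quotient (f : R * (R * R) * R -> R) q v :
  (fun h : R => h^-1 *: ((trace0 f \o shift q) (h *: v) - trace0 f q))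
  = (fun h : R => h^-1 *: ((f \o shift (q, 0)) (h *: (v, 0)) - f (q, 0))).
Proof.
apply/funext => h; congr (_ *: (_ - _)).
by rewrite /trace0; congr f; congr (_, _); rewrite /= scaler0 addr0.
Qed.

Lemma derive_trace0 (f : R * (R * R) * R -> R) q v :
  'D_v (trace0 f) q = 'D_(v, 0) f (q, 0).
Proof. by rewrite /derive trace0_quotient. Qed.

Lemma derivable_trace0 (f : R * (R * R) * R -> R) q v :
  derivable f (q, 0) (v, 0) -> derivable (trace0 f) q v.
Proof. by rewrite /derivable trace0_quotient. Qed.

Lemma continuous_trace0 (f : R * (R * R) * R -> R) q :
  {for (q, 0), continuous f} -> {for q, continuous (trace0 f)}.
Proof.
move=> cf; apply: (continuous_comp (f := fun q => (q, 0))); last exact: cf.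
by apply: continuous_pair; [exact: cvg_id|exact: cst_continuous].
Qed.

Lemma C1_on_trace0 O (f : R * (R * R) * R -> R) :
  C1_on O f -> C1_on [set q | O (q, 0)] (trace0 f).
Proof.
move=> Cf q /= Oq; have [cf df cdf] := Cf _ Oq; split.
- exact: continuous_trace0.
- by move=> v; apply: derivable_trace0; exact: df.
move=> v; rewrite (_ : 'D_v (trace0 f) = trace0 ('D_(v, 0) f)).
  by apply: continuous_trace0; exact: cdf.
by apply/funext => q'; rewrite derive_trace0.
Qed.

Lemma open_trace0 (O : set (R * (R * R) * R)) : open O -> open [set q | O (q, 0)].
Proof.
move=> oO; apply: (@open_comp _ _ (fun q => (q, 0)) O) => // q _.
by apply: continuous_pair; [exact: cvg_id|exact: cst_continuous].
Qed.

Lemma open_during (T : R) : open (during T).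
Proof.
have -> : during T = (fun q => q.1) @^-1` `]0, T[%classic.
  by apply/seteqP; split=> q; rewrite /during/= in_itv.
by apply: open_comp; [move=> q _; exact: cvg_fst|exact: interval_open].
Qed.

End Surface.

Section Constants.
Variable R : realType.

(** Vanishing along a line suffices. This matters for the bottom condition, which holds on a
    hypersurface and is to be differentiated in time. *)
Lemma derive_eq0_line (V : normedModType R) (f : V -> R) (p v : V) (d : R) :
  is_derive p v f d -> (\forall h \near (0 : R), f (p + h *: v) = 0) -> d = 0.
Proof.
move=> /is_derive_add_line [_ <-] f0.
by rewrite (near_eq_derive (1 : R) f0) derive_cst.
Qed.

Lemma slip_conditionE (b : R * R -> R) X (V : 'I_3 -> R) :
  \sum_(i < 3) bottom_normal b X i 0 * V i = 0 ->
  V ver + \sum_(j < 2) 'D_(ex R j) b X * V (hor j) = 0.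
Proof.
set s := Num.sqrt (1 + \sum_(j < 2) ('D_(ex R j) b X) ^+ 2).
have s0 : s != 0.
  rewrite sqrtr_eq0 -ltNge ltr_pwDl ?ltr01//.
  by apply: sumr_ge0 => j _; exact: sqr_ge0.
move=> H; apply: (mulfI (_ : - s^-1 != 0)); first by rewrite oppr_eq0 invr_eq0.
rewrite mulr0 -[RHS]H sum3E addrC mulrDr mulr_sumr.
congr (_ + _); last by rewrite !mxE unlift_none /=; rewrite /s; ring.
apply: eq_bigr => j _; rewrite !mxE.
rewrite (_ : unlift ver (hor j) = Some j); last by rewrite /hor /ver liftK.
by rewrite /= mulrA.
Qed.

(** The rate imposed on the wave. It is not integrable over the plane, but its square is. *)
Definition decay_radial (X : R * R) : R := (1 + enorm X ^+ 2)^-1.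

Lemma enormE (X : R * R) : enorm X ^+ 2 = X.1 ^+ 2 + X.2 ^+ 2.
Proof. by rewrite sqr_sqrtr// addr_ge0// sqr_ge0. Qed.

(** With [x = X.1^2] and [y = X.2^2], [(1+x+y)^2 - (1+x)(1+y) = x + y + x^2 + y^2 + xy] is
    nonnegative. *)
Lemma decay_radial_sqr X : decay_radial X * decay_radial X <= decay2 X.
Proof.
rewrite /decay_radial /decay2 /decay /oneDsqr enormE -!invfM.
have x0 := sqr_ge0 X.1; have y0 := sqr_ge0 X.2.
rewrite lef_pV2 ?posrE; [|by nra..].
by nra.
Qed.

Lemma decay_radialM (a c M N : R) X : `|a| <= M * decay_radial X ->
  `|c| <= N * decay_radial X -> `|a * c| <= M * N * decay2 X.
Proof.
move=> ha hc; rewrite normrM.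
have M0 : 0 <= M * decay_radial X := le_trans (normr_ge0 _) ha.
have N0 : 0 <= N * decay_radial X := le_trans (normr_ge0 _) hc.
have d0 : 0 < decay_radial X by rewrite invr_gt0 ltr_pwDl ?ltr01 ?sqr_ge0.
rewrite (pmulr_lge0 _ d0) in M0; rewrite (pmulr_lge0 _ d0) in N0.
rewrite (le_trans (ler_pM _ _ ha hc))// mulrACA.
by rewrite ler_wpM2l ?mulr_ge0 ?decay_radial_sqr.
Qed.

(** On the square of half-side [|R0|] the slope is bounded by compactness; off it [b] is locally
    constant and the slope vanishes. *)
Lemma bathymetry_slope_bounded (bmin bmax R0 : R) (b : R * R -> R) :
  bathymetry bmin bmax R0 b ->
  exists B, forall X j, `|'D_(ex R j) b X| <= B.
Proof.
case=> -[Q [oQ QT Cb]] _ _ far.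
have {}Cb : C1_on setT b by apply: C1_onS QT _; exact: Ck_on_C1 (Cb 1%N).
pose a := `|R0|; pose box : set (R * R) := `[- a, a]%classic `*` `[- a, a]%classic.
have cbox : compact box by apply: compact_setX; exact: segment_compact.
have box0 : box !=set0.
  by exists (0, 0); split; rewrite /= in_itv/= oppr_le0 normr_ge0.
have bnd j : exists B, forall X, `|'D_(ex R j) b X| <= B.
  have cd : {within box, continuous (fun X => `|'D_(ex R j) b X|)}.
    apply: continuous_subspaceT => X; apply: cvg_norm.
    by have [_ _] := Cb X I; exact.
  have [c _ cmax] := compact_EVT_max box0 cbox cd.
  exists `|'D_(ex R j) b c| => X.
  have [Xb|Xb] := pselect (box X); first by apply: cmax; rewrite inE.
  suff -> : 'D_(ex R j) b X = 0 by rewrite normr0.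
  have oout : open (~` box).
    by apply: closed_openC; apply: compact_closed cbox; exact: norm_hausdorff.
  rewrite (@near_eq_derive _ _ _ _ (cst bmax)) ?derive_cst//.
  apply: filterS (open_nbhs_nbhs (conj oout Xb)) => Y Yb; apply: far.
  rewrite ltNge; apply/negP => YR; apply: Yb.
  have YR2 : Y.1 ^+ 2 + Y.2 ^+ 2 <= a ^+ 2.
    rewrite -enormE ler_pXn2r ?nnegrE ?sqrtr_ge0 ?normr_ge0//.
    by rewrite (le_trans YR)// ler_norm.
  have x0 := sqr_ge0 Y.1; have y0 := sqr_ge0 Y.2; have a0 : 0 <= a := normr_ge0 _.
  by split; rewrite /= in_itv/= -ler_norml -ler_sqr ?nnegrE// real_normK ?num_real//; nra.
have [B0 HB0] := bnd ord0; have [B1 HB1] := bnd ord_max.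
exists (Num.max B0 B1) => X j; rewrite le_max.
case: j => [[|[|//]] jlt]; apply/orP; [left|right].
  by rewrite (_ : Ordinal jlt = ord0)//; exact: val_inj.
by rewrite (_ : Ordinal jlt = ord_max)//; exact: val_inj.
Qed.

End Constants.

(** * Decaying functions *)

Section Tame.
Variables (R : realType) (V : normedModType R).
Implicit Types (f g w : V -> R) (A O D : set V).

Definition bounded_by A w f := exists N, forall p, A p -> `|f p| <= N * w p.

(** Derivatives are taken on the open set [O]; the bounds hold on [A], such as a layer with its
    surface and bottom; [D] holds the directions of the bounded derivatives, which include time for
    the wave and only space for the current. *)
Definition tame O A D w f :=
  [/\ C1_on O f, bounded_by A w f & forall v, D v -> bounded_by A w ('D_v f)].

Lemma bounded_by_eq A w f g : (forall p, A p -> f p = g p) ->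
  bounded_by A w f -> bounded_by A w g.
Proof. by move=> fg [N HN]; exists N => p Ap; rewrite -fg//; exact: HN. Qed.

Lemma bounded_byD A w f g : bounded_by A w f -> bounded_by A w g ->
  bounded_by A w (f + g).
Proof.
move=> [N HN] [N' HN']; exists (N + N') => p Ap.
by rewrite (le_trans (ler_normD _ _))// mulrDl lerD// ?HN ?HN'.
Qed.

(** How weights multiply is left as a hypothesis because two rules occur: the radial rate times
    itself is below [decay2], and a weight times 1, for the current, is itself. *)
Lemma bounded_byM A w1 w2 w f g :
  (forall p a c M N, A p -> `|a| <= M * w1 p -> `|c| <= N * w2 p ->
    `|a * c| <= M * N * w p) ->
  bounded_by A w1 f -> bounded_by A w2 g -> bounded_by A w (f * g).
Proof.
move=> H [N HN] [N' HN']; exists (N * N') => p Ap.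
by apply: H; [|exact: HN|exact: HN'].
Qed.

Lemma bounded_byZ A w c f : bounded_by A w f -> bounded_by A w (c \*o f).
Proof.
by move=> [N HN]; exists (`|c| * N) => p Ap; rewrite /= normrM -mulrA ler_wpM2l ?HN.
Qed.

Lemma C1_deriveD O f g p v : C1_on O f -> C1_on O g -> O p ->
  'D_v (f + g) p = 'D_v f p + 'D_v g p.
Proof.
move=> Hf Hg Op; have [_ df _] := Hf p Op; have [_ dg _] := Hg p Op.
by rewrite deriveD; [|exact: df|exact: dg].
Qed.

Lemma C1_deriveM O f g p v : C1_on O f -> C1_on O g -> O p ->
  'D_v (f * g) p = f p * 'D_v g p + g p * 'D_v f p.
Proof.
move=> Hf Hg Op; have [_ df _] := Hf p Op; have [_ dg _] := Hg p Op.
by rewrite deriveM; [|exact: df|exact: dg].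
Qed.

Lemma C1_deriveZ O c f p v : C1_on O f -> O p -> 'D_v (c \*o f) p = c * 'D_v f p.
Proof. by move=> Hf Op; rewrite deriveMl//; have [_ d _] := Hf p Op; exact: d. Qed.

Variables (O A D : set V).
Hypotheses (oO : open O) (AO : A `<=` O).

Lemma tameD w f g : tame O A D w f -> tame O A D w g -> tame O A D w (f + g).
Proof.
move=> [Cf bf df] [Cg bg dg]; split; [exact: C1_onD|exact: bounded_byD|].
move=> v Dv; apply: (@bounded_by_eq _ _ ('D_v f + 'D_v g)).
  by move=> p /AO Op; rewrite (C1_deriveD v Cf Cg Op).
by apply: bounded_byD; [exact: df|exact: dg].
Qed.

Lemma tameM w1 w2 w f g :
  (forall p a c M N, A p -> `|a| <= M * w1 p -> `|c| <= N * w2 p ->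
    `|a * c| <= M * N * w p) ->
  tame O A D w1 f -> tame O A D w2 g -> tame O A D w (f * g).
Proof.
move=> H [Cf bf df] [Cg bg dg].
have H' p a c M N : A p -> `|a| <= M * w2 p -> `|c| <= N * w1 p -> `|a * c| <= M * N * w p.
  by move=> Ap ha hc; rewrite mulrC (mulrC M); exact: H.
split; [exact: C1_onM|exact: bounded_byM H bf bg|].
move=> v Dv; apply: (@bounded_by_eq _ _ (f * 'D_v g + g * 'D_v f)).
  by move=> p /AO Op; rewrite (C1_deriveM v Cf Cg Op).
apply: bounded_byD; first exact: bounded_byM H bf (dg v Dv).
exact: bounded_byM H' bg (df v Dv).
Qed.

Lemma tameZ w c f : tame O A D w f -> tame O A D w (c \*o f).
Proof.
move=> [Cf bf df]; split; [exact: C1_onZ|exact: bounded_byZ|].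
move=> v Dv; apply: (@bounded_by_eq _ _ (c \*o 'D_v f)).
  by move=> p /AO Op; rewrite (C1_deriveZ c v Cf Op).
by apply: bounded_byZ; exact: df.
Qed.

Lemma tameB w f g : tame O A D w f -> tame O A D w g -> tame O A D w (f - g).
Proof.
move=> tf tg; have -> : f - g = f + ((-1) \*o g).
  by congr (_ + _); apply/funext => p /=; rewrite mulN1r.
by apply: tameD; [exact: tf|exact: tameZ].
Qed.

Lemma tame_sum w n (F : 'I_n.+1 -> V -> R) :
  (forall i, tame O A D w (F i)) -> tame O A D w (\sum_i F i).
Proof.
elim: n F => [|n IH] F tF; first by rewrite big_ord1; exact: tF.
by rewrite big_ord_recl; apply: tameD; [exact: tF|apply: IH => i; exact: tF].
Qed.

End Tame.

Lemma bounded_by_unif (R : realType) (V : normedModType R) (I : finType)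
    (A : set V) (w : V -> R) (f : I -> V -> R) :
  (forall p, A p -> 0 <= w p) -> (forall i, bounded_by A w (f i)) ->
  exists N, forall i p, A p -> `|f i p| <= N * w p.
Proof.
move=> w0 /choice[N HN]; exists (\sum_i `|N i|) => i p Ap.
rewrite (le_trans (HN i p Ap))// ler_wpM2r ?w0// (bigD1 i)//=.
by rewrite (le_trans (ler_norm _))// lerDl sumr_ge0.
Qed.

Section WaveFluxes.
Variables (R : realType) (T bmin bmax R0 : R) (b : R * R -> R).
Hypothesis bathy : bathymetry bmin bmax R0 b.
Local Notation leb2 := (@lebesgue_measure R \x @lebesgue_measure R)%E.
Local Notation leb3 :=
  ((@lebesgue_measure R \x @lebesgue_measure R) \x @lebesgue_measure R)%E.
Local Notation water := (layer T b (cst 0)).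

Lemma C1_on_bathymetry : C1_on setT b.
Proof.
have [[Q [oQ QT Cb]] _ _ _] := bathy.
by apply: C1_onS QT _; exact: Ck_on_C1 (Cb 1%N).
Qed.

Lemma bathymetry_gt0 X : 0 < b X.
Proof. by have [_ b0 /(_ X)/andP[bX _] _] := bathy; exact: lt_le_trans bX. Qed.

Lemma water_flux (t : R) O (F : 'I_3 -> R * (R * R) * R -> R) :
  0 < t < T -> open O -> water `<=` O ->
  (forall i, tame O water (range (eb R)) (fun p => decay2 p.1.2) (F i)) ->
  (forall q, during T q ->
    \sum_(i < 3) bottom_normal b q.2 i 0 * F i (Defs.bottom b q) = 0) ->
  \int[leb3]_(Y in Omega b) divergence F (t, Y.1, Y.2) = \int[leb2]_X F ver (t, X, 0).
Proof.
move=> tT oO wO tF Fb.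
have Cb := C1_on_bathymetry.
have [B HB] := bathymetry_slope_bounded bathy.
have wat X z : - b X <= z <= 0 -> water (t, X, z).
  by move=> /andP[z1 z2]; split.
have dpos (p : R * (R * R) * R) : water p -> 0 <= decay2 p.1.2.
  by move=> _; exact: decay2_ge0.
have [M0 HM0] := @bounded_by_unif R _ _ water _ F dpos
   (fun i => let: And3 _ h _ := tF i in h).
have [M1 HM1] := @bounded_by_unif R _ ('I_3 * 'I_3)%type water _
   (fun ik => 'D_(eb R ik.2) (F ik.1)) dpos
   (fun ik => let: And3 _ _ h := tF ik.1 in h _ (ex_intro2 _ _ ik.2 I erefl)).
apply: (@flux_through_surface R b (fun j X => 'D_(ex R j) b X) bmax B _ _ _ _ _
  t (Num.max M0 M1) O).
- move=> X; have [_ _ /(_ X)/andP[_ bX] _] := bathy.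
  by rewrite bathymetry_gt0.
- by move=> X j; exact: (C1_is_derive _ Cb).
- by move=> X; have [] := Cb X I.
- by move=> j X; have [_ _] := Cb X I; exact.
- exact: HB.
- exact: oO.
- by move=> X z /wat; exact: wO.
- by move=> i; have [] := tF i.
- move=> i X z /wat /HM0 H; rewrite (le_trans (H i))// ler_wpM2r ?decay2_ge0//.
  by rewrite le_max lexx.
- move=> i k X z /wat /HM1 H; rewrite (le_trans (H (i, k)))// ler_wpM2r ?decay2_ge0//.
  by rewrite le_max lexx orbT.
- by move=> X; have := slip_conditionE (Fb (t, X) tT).
Qed.

Lemma shift_es (t h : R) (X : R * R) (j : 'I_2) :
  (t, X) + h *: es R j = (t, X + h *: ex R j).
Proof. by congr (_, _); rewrite /= [_ *: _]mulr0 addr0. Qed.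

Lemma is_derive_slice (f : R * (R * R) -> R) (t : R) X j d :
  is_derive (t, X) (es R j) f d -> is_derive X (ex R j) (fun X => f (t, X)) d.
Proof.
move=> /is_derive_add_line H; apply: is_derive_from_line.
by under eq_fun do rewrite -shift_es.
Qed.

Lemma continuous_slice (f : R * (R * R) -> R) (t : R) :
  (forall X, {for (t, X), continuous f}) -> continuous (fun X => f (t, X)).
Proof.
move=> cf X; apply: (continuous_comp (f := fun X => (t, X))); last exact: cf.
by apply: continuous_pair; [exact: cst_continuous|exact: cvg_id].
Qed.

Lemma integrable_slice (f : R * (R * R) -> R) (t : R) :
  0 < t < T -> (forall X, {for (t, X), continuous f}) ->
  bounded_by (during T) (fun q => decay2 q.2) f ->
  leb2.-integrable setT (EFin \o (fun X => f (t, X))).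
Proof.
move=> tT cf [N HN]; apply: (@integrable_plane R (fun X => f (t, X)) N).
  exact: continuous_slice.
by move=> X; exact: HN.
Qed.

Lemma Rintegral_slice_derive0 S (f : R * (R * R) -> R) (t : R) (j : 'I_2) :
  0 < t < T -> during T `<=` S ->
  tame S (during T) (range (es R)) (fun q => decay2 q.2) f ->
  \int[leb2]_X 'D_(es R j) f (t, X) = 0.
Proof.
move=> tT dS [Cf [M0 HM0] /(_ _ (ex_intro2 _ _ j I erefl))[M1 HM1]].
have SX X : S (t, X) by apply: dS.
apply: (@Rintegral_plane_derive0 R j (fun X => f (t, X))
  (fun X => 'D_(es R j) f (t, X)) (Num.max M0 M1)).
- by apply: (@continuous_slice ('D_(es R j) f) t) => X; have [_ _] := Cf _ (SX X); exact.
- by move=> X; apply: is_derive_slice; exact: (C1_is_derive _ Cf).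
- move=> X; rewrite (le_trans (HM0 (t, X) tT))// ler_wpM2r ?decay2_ge0//.
  by rewrite le_max lexx.
- move=> X; rewrite (le_trans (HM1 (t, X) tT))// ler_wpM2r ?decay2_ge0//.
  by rewrite le_max lexx orbT.
Qed.

End WaveFluxes.

(** * The two fluxes *)

Section ThreeIndices.
Let i0 : 'I_3 := ord0.
Let i1 : 'I_3 := lift ord0 ord0.
Let i2 : 'I_3 := lift ord0 (lift ord0 ord0).

Lemma big_ord3 (V : zmodType) (f : 'I_3 -> V) :
  \sum_(i < 3) f i = f i0 + f i1 + f i2.
Proof. by rewrite !big_ord_recl big_ord0 addr0 addrA. Qed.

(* The derivative of 1/2 |u|^2 U_i - (u . U) u_i in terms of the derivatives
   a and d of u and U. *)
Let flux_derivative (R : realType) (u U a d : 'I_3 -> R) (i : 'I_3) : R :=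
  2^-1 * (\sum_(j < 3) u j * u j) * d i + U i * (\sum_(j < 3) u j * a j)
  - (\sum_(j < 3) u j * U j) * a i - u i * \sum_(j < 3) (u j * d j + U j * a j).

(** The vanishing traces remove the terms with [A i i] and [D i i]. The two remaining sums of
    [u U A] cancel because [A] is symmetric, and [- sum u_i u_j D_ij] only sees the symmetric part
    of [D]. *)
Let flux_divergence (R : realType) (u U : 'I_3 -> R) (A D : 'I_3 -> 'I_3 -> R) :
  (forall i j, A i j = A j i) -> \sum_i A i i = 0 -> \sum_i D i i = 0 ->
  \sum_i flux_derivative u U (A i) (D i) i
  = - \sum_i u i * \sum_j (2^-1 * (D j i + D i j)) * u j.
Proof.
move=> AS; rewrite /flux_derivative !big_ord3 => /eqP; rewrite addr_eq0 => /eqP aE.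
move=> /eqP; rewrite addr_eq0 => /eqP dE.
(* Eliminating the dependent entries of [A] and [D] leaves an identity in independent variables. *)
rewrite (AS i1 i0) (AS i2 i0) (AS i2 i1).
have -> : A i2 i2 = - (A i0 i0 + A i1 i1) by rewrite aE opprK.
have -> : D i2 i2 = - (D i0 i0 + D i1 i1) by rewrite dE opprK.
by field.
Qed.

Let is_derive_flux (R : realType) (V : normedModType R) (u U : 'I_3 -> V -> R)
    (a d : 'I_3 -> R) (p v : V) (i : 'I_3) :
  (forall j, is_derive p v (u j) (a j)) -> (forall j, is_derive p v (U j) (d j)) ->
  is_derive p v
    ((2^-1 \*o \sum_(j < 3) (u j * u j)) * U i - (\sum_(j < 3) (u j * U j)) * u i)
    (flux_derivative (u ^~ p) (U ^~ p) a d i).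
Proof.
move=> du dU; rewrite !big_ord3.
have dS := is_deriveD (is_deriveD (is_deriveM (du i0) (du i0)) (is_deriveM (du i1) (du i1)))
  (is_deriveM (du i2) (du i2)).
have dQ := is_deriveD (is_deriveD (is_deriveM (du i0) (dU i0)) (is_deriveM (du i1) (dU i1)))
  (is_deriveM (du i2) (dU i2)).
have H := is_deriveB (is_deriveM (is_deriveZ 2^-1 dS) (dU i)) (is_deriveM dQ (du i)).
apply: is_derive_eq H _.
rewrite /flux_derivative !big_ord3 /GRing.scale /= !fctE /GRing.scale /=.
by field.
Qed.

Variables (R : realType) (O : set (R * (R * R) * R)).
Variables (Phi : R * (R * R) * R -> R) (U : 'I_3 -> R * (R * R) * R -> R).
Hypotheses (oO : open O) (CPhi : Ck_on 3 O Phi) (CU : forall i, C1_on O (U i)).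

Let u j := 'D_(eb R j) Phi.
Let Psi := 'D_ebt Phi.

(* Its divergence is -u . S(U) u when u = grad Phi and U are divergence free. *)
Definition production_flux (i : 'I_3) : R * (R * R) * R -> R :=
  (2^-1 \*o \sum_(j < 3) ('D_(eb R j) Phi * 'D_(eb R j) Phi)) * U i
  - (\sum_(j < 3) ('D_(eb R j) Phi * U j)) * 'D_(eb R i) Phi.

(* Green's second identity for Phi and its time derivative, which gives the
   symmetry of the Dirichlet-to-Neumann operator. *)
Definition green_flux (i : 'I_3) : R * (R * R) * R -> R :=
  Phi * 'D_(eb R i) ('D_ebt Phi) - 'D_ebt Phi * 'D_(eb R i) Phi.

Let Cu v : C1_on O ('D_v Phi).
Proof. exact: (Ck_on_C1 (@Ck_on_derive R _ 2 O Phi v CPhi)). Qed.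

Let CPhi1 : C1_on O Phi.
Proof. exact: Ck_on_C1 CPhi. Qed.

Let CdPsi v w : C1_on O ('D_v ('D_w Phi)).
Proof. exact: (Ck_on_C1 (@Ck_on_derive R _ 1 O _ v (@Ck_on_derive R _ 2 O Phi w CPhi))). Qed.

Let swap p v w : O p -> 'D_w ('D_v Phi) p = 'D_v ('D_w Phi) p.
Proof. by move=> Op; apply: (Ck_on_swap v w oO (Ck_onW _ CPhi) Op). Qed.

Lemma div_production_flux p : O p -> laplacian Phi p = 0 -> divergence U p = 0 ->
  divergence production_flux p = production U Phi p.
Proof.
move=> Op lap div.
pose A i j := 'D_(eb R i) ('D_(eb R j) Phi) p.
pose D i j := 'D_(eb R i) (U j) p.
have prodE : ((grad Phi p)^T *m (strain U p *m grad Phi p)) 0 0 =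
  \sum_i u i p * \sum_j (2^-1 * (D j i + D i j)) * u j p.
  rewrite mxE; apply: eq_bigr => i _; rewrite !mxE; congr (_ * _).
  by apply: eq_bigr => j _; rewrite !mxE.
rewrite /production prodE.
have AS i j : A i j = A j i by exact: swap.
apply: etrans (flux_divergence (u ^~ p) (U ^~ p) AS lap div).
apply: eq_bigr => i _.
have [||_] := @is_derive_flux R _ u U (A i) (D i) p (eb R i) i; last exact.
  by move=> j; exact: (C1_is_derive _ (Cu _) Op).
by move=> j; exact: (C1_is_derive _ (@CU j) Op).
Qed.

(** The products of first derivatives cancel. *)
Lemma div_green_flux p : O p ->
  divergence green_flux p = Phi p * laplacian Psi p - Psi p * laplacian Phi p.
Proof.
move=> Op; rewrite /divergence /laplacian !mulr_sumr -sumrB; apply: eq_bigr => i _.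
have dPhi w := C1_is_derive w CPhi1 Op.
have du w w' := C1_is_derive w (@Cu w') Op.
have ddu w w' w'' := C1_is_derive w (@CdPsi w' w'') Op.
have H := is_deriveB (is_deriveM (dPhi (eb R i)) (ddu (eb R i) (eb R i) ebt))
  (is_deriveM (du (eb R i) ebt) (du (eb R i) (eb R i))).
have [_ E] := H; apply: etrans E _.
rewrite /GRing.scale /= -/Psi.
move: ('D_(eb R i) ('D_(eb R i) Psi) p) => x.
move: ('D_(eb R i) ('D_(eb R i) Phi) p) => y.
by rewrite opprD addrACA mulrC (mulrC (Psi p)); ring.
Qed.

(** The time derivative is moved through both space derivatives of the Laplacian, which takes [Phi]
    of class C^3. *)
Lemma laplacian_dt p : O p ->
  (\forall h \near (0 : R), laplacian Phi (p + h *: ebt) = 0) ->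
  laplacian Psi p = 0.
Proof.
move=> Op lap0.
have nO : \forall q \near p, O q := open_nbhs_nbhs (conj oO Op).
have C2 v : Ck_on 2 O ('D_v Phi) := @Ck_on_derive R _ 2 O Phi v CPhi.
have E i : 'D_(eb R i) ('D_(eb R i) Psi) p = 'D_ebt ('D_(eb R i) (u i)) p.
  apply: etrans (Ck_on_swap ebt (eb R i) oO (C2 (eb R i)) Op).
  apply: near_eq_derive; apply: filterS nO => q Oq.
  exact: (swap ebt (eb R i) Oq).
have ddu i := C1_is_derive ebt (@CdPsi (eb R i) (eb R i)) Op.
have lapE : laplacian Phi =
    'D_(eb R i0) (u i0) + 'D_(eb R i1) (u i1) + 'D_(eb R i2) (u i2).
  by apply/funext => q; rewrite /laplacian big_ord3.
have H := is_deriveD (is_deriveD (ddu i0) (ddu i1)) (ddu i2).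
rewrite -lapE in H.
apply: etrans (derive_eq0_line H lap0).
rewrite /laplacian big_ord3.
exact: (congr2 +%R (congr2 +%R (E i0) (E i1)) (E i2)).
Qed.

End ThreeIndices.

(** * Bounds on the current and on the wave *)

Lemma Ck_on_iter_C1 (R : realType) (V : normedModType R) k (Q : set V) (f : V -> R) vs :
  Ck_on k Q f -> (size vs < k)%N -> C1_on Q (iter_deriv vs f).
Proof.
move=> Cf vk p Qp; have [cf df] := Cf vs (ltnW vk) p Qp; split; first exact: cf.
  exact: df vk.
by move=> v; have [] := Cf (v :: vs) vk p Qp.
Qed.

Lemma tameS (R : realType) (V : normedModType R) (Q Q' A A' D D' : set V) w (f : V -> R) :
  Q' `<=` Q -> A' `<=` A -> D' `<=` D -> tame Q A D w f -> tame Q' A' D' w f.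
Proof.
move=> QQ AA DD [Cf [N bf] df]; split; first exact: C1_onS QQ Cf.
  by exists N => p /AA; exact: bf.
by move=> v /DD /df [M HM]; exists M => p /AA; exact: HM.
Qed.

Section SurfaceSpeed.
Variables (R : realType) (K : nat -> R) (Ks g delta T : R) (b : R * R -> R).
Variables (U : 'I_3 -> R * (R * R) * R -> R) (etab : R * (R * R) -> R)
  (press : R * (R * R) * R -> R) (patm : R * (R * R) -> R).
Hypothesis delta01 : 0 < delta < 1.
Hypothesis b_gt0 : forall X, 0 < b X.
Hypothesis bg : background_current K Ks g delta T b U etab press patm.

Local Notation fluid := (layer T b (fun q => Num.max 0 (etab q))).

Lemma bounded_current i p : fluid p -> `|U i p| <= `|K 0|.
Proof.
move=> Lp; have := bg_slow bg i [::] Lp; rewrite expr0 mulr1 => H.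
exact: le_trans H (ler_norm _).
Qed.

Lemma slow_current i k p : fluid p -> `|'D_(eb R k) (U i) p| <= `|K 1| * delta.
Proof.
move=> Lp; have /= H := bg_slow bg i [:: k] Lp; rewrite expr1 in H.
rewrite (le_trans H)// ler_wpM2r ?ler_norm//.
by case/andP: delta01 => /ltW.
Qed.

(* The kinematic condition holds at z = etab; the mean value theorem carries
   it over to z = 0. *)
Lemma vertical_current_surface q : during T q ->
  `|U ver (q, 0)| <= `|Ks| * (1 + 2 * `|K 0| + `|K 1|) * delta.
Proof.
move=> Tq; have /andP[d0 d1] := delta01.
have eb_lt := bg_elev_bottom bg Tq.
(* The segment between [z = 0] and [z = etab] stays in the layer where the current is given: below
   [max(0, etab)], and above the bottom because both [-b < 0] and [-b < etab]. *)
have segment s : 0 <= s <= 1 -> fluid (q, s * etab q).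
  move=> /andP[s0 s1]; have bq := b_gt0 q.2; split=> //=.
    have [e0|e0] := leP 0 (etab q).
      by rewrite (@le_trans _ _ 0) ?oppr_le0 ?mulr_ge0// ltW.
    rewrite (le_trans (ltW eb_lt))// -[X in X <= _]mul1r.
    by rewrite (@ler_wnM2r _ (etab q) (ltW e0)).

  rewrite le_max; have [e0|e0] := leP 0 (etab q).
    by rewrite ler_piMl ?orbT.
  by rewrite mulr_ge0_le0// ltW.
have [Q [oQ LQ CQ]] := bg_smooth bg ver.
have CU := Ck_on_C1 (CQ 1%N).
have [|s /andP[s0 s1]] := @mvt_segment R _ (U ver) (q, 0) (eb R ver) (etab q).
  move=> s sI; rewrite shift_ver add0r; have [_ d _] := CU _ (LQ _ (segment s sI)).
  exact: d.
rewrite !shift_ver !add0r => mvt.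
have -> : U ver (q, 0) = U ver (q, etab q)
    - etab q * 'D_(eb R ver) (U ver) (q, s * etab q) by rewrite -mvt opprB addrC subrK.
set k := `|Ks|.
have Kd : Ks * delta <= k * delta by rewrite ler_wpM2r ?ler_norm// ltW.
have kd0 : 0 <= k * delta by rewrite mulr_ge0 ?normr_ge0 ?ltW.
have e1 : `|etab q| <= k * delta := le_trans (bg_elev_size bg Tq) Kd.
have e2 : `|'D_est etab q| <= k * delta := le_trans (bg_elev_dt bg Tq) Kd.
have e3 j : `|'D_(es R j) etab q| <= k * delta := le_trans (bg_elev_dx bg j Tq) Kd.
have f1 : fluid (q, etab q) by have := segment 1; rewrite mul1r; apply; rewrite ler01 lexx.
have fs : fluid (q, s * etab q) by apply: segment; rewrite !ltW.
have u1 j : `|U (hor j) (q, etab q) * 'D_(es R j) etab q| <= `|K 0| * (k * delta).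
  by rewrite normrM ler_pM ?normr_ge0 ?e3// bounded_current.
(* This product is of order [delta^2]; [delta < 1] brings it to order [delta]. *)
have u2 : `|etab q * 'D_(eb R ver) (U ver) (q, s * etab q)| <= (k * delta) * `|K 1|.
  rewrite normrM ler_pM ?normr_ge0 ?e1// (le_trans (slow_current _ _ fs))//.
  by rewrite ler_piMr ?normr_ge0// ltW.
rewrite -(bg_kinematic bg Tq) big_ord_recl big_ord1.
apply: le_trans (ler_normB _ _) _.
(* The summands come from the time derivative of [etab], the two horizontal transport terms, and the
   passage from [z = etab] to [z = 0]. *)
have -> : k * (1 + 2 * `|K 0| + `|K 1|) * delta =
  (k * delta + (`|K 0| * (k * delta) + `|K 0| * (k * delta))) + (k * delta) * `|K 1|.
  by ring.
apply: lerD u2; apply: le_trans (ler_normD _ _) _; apply: lerD e2 _.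
by apply: le_trans (ler_normD _ _) _; exact: lerD.
Qed.

Lemma water_fluid : layer T b (cst 0) `<=` fluid.
Proof. by move=> p [h1 h2 h3]; split=> //; rewrite le_max h3. Qed.

Lemma C1_current i : exists Q, [/\ open Q, layer T b (cst 0) `<=` Q & C1_on Q (U i)].
Proof.
have [Q [oQ LQ CQ]] := bg_smooth bg i; exists Q; split=> //.
  exact: subset_trans water_fluid LQ.
exact: Ck_on_C1 (CQ 1%N).
Qed.

Lemma tame_current Q i : C1_on Q (U i) ->
  tame Q (layer T b (cst 0)) (range (eb R)) (cst 1) (U i).
Proof.
move=> CU; split; first exact: CU.
  by exists `|K 0| => p /water_fluid Lp; rewrite mulr1 bounded_current.
move=> _ [k _ <-]; exists (`|K 1| * delta) => p /water_fluid Lp.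
by rewrite mulr1 slow_current.
Qed.

End SurfaceSpeed.

Section WaveTame.
Variables (R : realType) (T : R) (b : R * R -> R).
Variables (eta : R * (R * R) -> R) (Phi : R * (R * R) * R -> R).
Hypothesis b_gt0 : forall X, 0 < b X.
Hypothesis reg : wave_regular T b eta Phi.

Local Notation water := (layer T b (cst 0)).

Definition bulk_directions : set (R * (R * R) * R) :=
  [set v | v \in (ebt : R * (R * R) * R) :: [seq eb R i | i : 'I_3]].
Definition surface_directions : set (R * (R * R)) :=
  [set v | v \in (est : R * (R * R)) :: [seq es R j | j : 'I_2]].

Lemma bulk_directions_eb : range (eb R) `<=` bulk_directions.
Proof. by move=> _ [i _ <-]; rewrite /bulk_directions/= inE map_f ?orbT// mem_enum. Qed.

Lemma bulk_directions_ebt : bulk_directions ebt.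
Proof. by rewrite /bulk_directions/= mem_head. Qed.

Lemma surface_directions_es : range (es R) `<=` surface_directions.
Proof. by move=> _ [i _ <-]; rewrite /surface_directions/= inE map_f ?orbT// mem_enum. Qed.

Lemma surface_directions_bulk v : surface_directions v -> bulk_directions (v, 0).
Proof.
rewrite /surface_directions/= inE => /orP[/eqP->|/mapP[j _ ->]].
  exact: bulk_directions_ebt.
by apply: bulk_directions_eb; exists (hor j) => //; exact: eb_hor.
Qed.

(** At most two derivatives are taken, since [tame] controls one more and the decay of [Phi] is
    given up to order three. *)
Lemma tame_potential Q vs : Ck_on 3 Q Phi -> {subset vs <= bulk_directions} ->
  (size vs <= 2)%N ->
  tame Q water bulk_directions (fun p => decay_radial p.1.2) (iter_deriv vs Phi).
Proof.
move=> CPhi vsD vs2; have [M HM] := reg_Phi_decay reg.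
split; first exact: Ck_on_iter_C1 CPhi _.
  exists M => p wp; apply: HM => //; last exact: leq_trans vs2 _.
  by move=> v /vsD; rewrite inE.
move=> v Dv; exists M => p wp; apply: (HM (v :: vs)) => //.
by move=> v'; rewrite inE => /orP[/eqP->//|/vsD]; rewrite inE.
Qed.

Lemma tame_elevation : exists Q, [/\ open Q, during T `<=` Q &
  tame Q (during T) surface_directions (fun q => decay_radial q.2) eta].
Proof.
have [Q [oQ TQ CQ]] := reg_eta reg; exists Q; split=> //.
have [M HM] := reg_eta_decay reg; split; first exact: Ck_on_C1 CQ.
  by exists M => q Tq; apply: (HM [::]).
move=> v Dv; exists M => q Tq; apply: (HM [:: v]) => //.
by move=> v'; rewrite inE => /eqP->.
Qed.

Lemma water_surface q : during T q -> water (q, 0).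
Proof. by move=> Tq; split=> //; rewrite oppr_le0 ltW. Qed.

Lemma tame_trace0 Q D D' w f : (forall v, D v -> D' (v, 0)) ->
  tame Q water D' w f ->
  tame [set q | Q (q, 0)] (during T) D (fun q => w (q, 0)) (trace0 f).
Proof.
move=> DD [Cf [N HN] df]; split; first exact: C1_on_trace0.
  by exists N => q /water_surface; exact: HN.
move=> v /DD /df [M HM]; exists M => q /water_surface /HM.
by rewrite derive_trace0.
Qed.

End WaveTame.

(** * The energy balance *)

Section EnergyBalance.
Variables (R : realType) (K : nat -> R) (Ks g delta T bmin bmax R0 : R).
Variables (b : R * R -> R) (U : 'I_3 -> R * (R * R) * R -> R)
  (etab : R * (R * R) -> R) (press : R * (R * R) * R -> R)
  (patm eta phi : R * (R * R) -> R) (Phi : R * (R * R) * R -> R).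
Hypothesis delta01 : 0 < delta < 1.
Hypothesis bathy : bathymetry bmin bmax R0 b.
Hypothesis bg : background_current K Ks g delta T b U etab press patm.
Hypothesis pot : wave_potential T b phi Phi.
Hypothesis reg : wave_regular T b eta Phi.
Hypothesis sys : wave_system g T U eta phi Phi.

Local Notation leb2 := (@lebesgue_measure R \x @lebesgue_measure R)%E.
Local Notation leb3 :=
  ((@lebesgue_measure R \x @lebesgue_measure R) \x @lebesgue_measure R)%E.
Local Notation water := (layer T b (cst 0)).
Local Notation r3 := (fun p : R * (R * R) * R => decay_radial p.1.2).
Local Notation q3 := (fun p : R * (R * R) * R => decay2 p.1.2).
Local Notation r2 := (fun q : R * (R * R) => decay_radial q.2).
Local Notation q2 := (fun q : R * (R * R) => decay2 q.2).

Let b_gt0 := bathymetry_gt0 bathy.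

Lemma common_domain : exists Q, [/\ open Q, water `<=` Q, Ck_on 3 Q Phi &
  forall i, C1_on Q (U i)].
Proof.
have [Q [oQ wQ CQ]] := reg_Phi reg.
have [Q0 [oQ0 wQ0 CQ0]] := C1_current bg (hor ord0).
have [Q1 [oQ1 wQ1 CQ1]] := C1_current bg (hor ord_max).
have [Q2 [oQ2 wQ2 CQ2]] := C1_current bg ver.
exists (Q `&` (Q0 `&` (Q1 `&` Q2))); split.
- by do 3 (apply: openI => //).
- by move=> p wp; split; [exact: wQ|split; [exact: wQ0|split; [exact: wQ1|exact: wQ2]]].
- by apply: Ck_onS CQ => p [].
case=> [[|[|[|//]]] ilt].
- rewrite (_ : Ordinal ilt = hor ord0); last exact: val_inj.
  by apply: C1_onS CQ0 => p [_ []].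
- rewrite (_ : Ordinal ilt = hor ord_max); last exact: val_inj.
  by apply: C1_onS CQ1 => p [_ [_ []]].
- rewrite (_ : Ordinal ilt = ver); last exact: val_inj.
  by apply: C1_onS CQ2 => p [_ [_ []]].
Qed.

Variable Q : set (R * (R * R) * R).
Hypotheses (oQ : open Q) (wQ : water `<=` Q) (CPhi : Ck_on 3 Q Phi)
  (CU : forall i, C1_on Q (U i)).

Lemma tame_Phi : tame Q water (@bulk_directions R) r3 Phi.
Proof. by apply: (tame_potential reg (vs := [::]) CPhi). Qed.

Lemma tame_dPhi v : bulk_directions v -> tame Q water (@bulk_directions R) r3 ('D_v Phi).
Proof.
move=> Dv; apply: (tame_potential reg (vs := [:: v]) CPhi) => // v'.
by rewrite !inE => /eqP->.
Qed.

Lemma tame_ddPhi v w : bulk_directions v -> bulk_directions w ->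
  tame Q water (@bulk_directions R) r3 ('D_v ('D_w Phi)).
Proof.
move=> Dv Dw; apply: (tame_potential reg (vs := [:: v; w]) CPhi) => // v'.
by rewrite !inE => /orP[] /eqP->.
Qed.

Let eb_dir i : bulk_directions (eb R i).
Proof. by apply: bulk_directions_eb; exists i. Qed.

Let ebt_dir : bulk_directions (ebt : R * (R * R) * R).
Proof. exact: bulk_directions_ebt. Qed.

Let to_eb w f : tame Q water (@bulk_directions R) w f -> tame Q water (range (eb R)) w f.
Proof. by apply: tameS => //; exact: bulk_directions_eb. Qed.

Let mul_rr (p : R * (R * R) * R) a c M N : water p -> `|a| <= M * r3 p ->
  `|c| <= N * r3 p -> `|a * c| <= M * N * q3 p.
Proof. by move=> _; exact: decay_radialM. Qed.

Let mul_w1 (w : R * (R * R) * R -> R) p a c M N : water p -> `|a| <= M * w p ->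
  `|c| <= N * cst 1 p -> `|a * c| <= M * N * w p.
Proof.
move=> _ ha hc; rewrite normrM (le_trans (ler_pM _ _ ha hc))//.
by rewrite /= mulr1 mulrAC.
Qed.

Let tU i : tame Q water (range (eb R)) (cst 1) (U i).
Proof. exact: tame_current delta01 bg _ _ (@CU i). Qed.

Let tu i : tame Q water (range (eb R)) r3 ('D_(eb R i) Phi).
Proof. exact: to_eb (tame_dPhi (eb_dir i)). Qed.

Let tuu i : tame Q water (range (eb R)) q3 ('D_(eb R i) Phi * 'D_(eb R i) Phi).
Proof. exact: (tameM oQ wQ mul_rr (tu i) (tu i)). Qed.

Lemma tame_production_flux i :
  tame Q water (range (eb R)) q3 (production_flux Phi U i).
Proof.
apply: (tameB oQ wQ).
  apply: (tameM oQ wQ (@mul_w1 q3) _ (tU i)); apply: (tameZ oQ wQ).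
  by apply: (tame_sum oQ wQ) => j; exact: tuu.
apply: (tameM oQ wQ mul_rr _ (tu i)); apply: (tame_sum oQ wQ) => j.
exact: (tameM oQ wQ (@mul_w1 r3) (tu j) (tU j)).
Qed.

Lemma tame_green_flux i : tame Q water (range (eb R)) q3 (green_flux Phi i).
Proof.
apply: (tameB oQ wQ).
  by apply: (tameM oQ wQ mul_rr); apply: to_eb; [exact: tame_Phi|exact: tame_ddPhi].
by apply: (tameM oQ wQ mul_rr); apply: to_eb; exact: tame_dPhi.
Qed.

(** At each point the flux is a linear combination of [U] and [grad Phi], both tangent to the
    bottom. *)
Lemma no_flux_production q : during T q ->
  \sum_(i < 3) bottom_normal b q.2 i 0 * production_flux Phi U i (Defs.bottom b q) = 0.
Proof.
move=> Tq; set p := Defs.bottom b q.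
have H1 := bg_bottom bg Tq; have H2 := pot_bottom pot Tq.
rewrite -/p in H1 H2.
rewrite /production_flux.
set S := \sum_(j < 3) ('D_(eb R j) Phi * 'D_(eb R j) Phi).
set P := \sum_(j < 3) ('D_(eb R j) Phi * U j).
have E i : bottom_normal b q.2 i 0 * ((2^-1 \*o S) * U i - P * 'D_(eb R i) Phi) p =
   (2^-1 * S p) * (bottom_normal b q.2 i 0 * U i p)
   - P p * (bottom_normal b q.2 i 0 * grad Phi p i 0).
  rewrite [grad _ _ _ _]mxE.
  rewrite -[(_ - _) p]/((2^-1 * S p) * U i p - P p * 'D_(eb R i) Phi p).
  by ring.
by rewrite (eq_bigr _ (fun i _ => E i)) sumrB -!mulr_sumr H1 H2 !mulr0 subr0.
Qed.

Let near_during q : during T q -> \forall h \near (0 : R), during T (q + h *: est).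
Proof.
move=> Tq.
have c : (q + h *: est) @[h --> (0 : R)] --> q.
  rewrite -[X in _ --> X]addr0 -(scale0r est); apply: cvgD; first exact: cvg_cst.
  by apply: cvgZr_tmp; exact: cvg_id.
exact: c _ (open_nbhs_nbhs (conj (@open_during R T) Tq)).
Qed.

Let shift_ebt (q : R * (R * R)) z (h : R) : (q, z) + h *: ebt = (q + h *: est, z).
Proof. by congr (_, _); rewrite /= [_ *: _]mulr0 addr0. Qed.

Let shift_est2 (q : R * (R * R)) (h : R) : (q + h *: est).2 = q.2.
Proof. by rewrite /= scaler0 addr0. Qed.

(** As [b] does not depend on time, the bottom condition can be differentiated in time, so the
    gradient of ['D_ebt Phi] is tangent to the bottom as well. *)
Lemma no_flux_green q : during T q ->
  \sum_(i < 3) bottom_normal b q.2 i 0 * green_flux Phi i (Defs.bottom b q) = 0.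
Proof.
move=> Tq; set p := Defs.bottom b q.
have wp : water p by split=> //=; rewrite oppr_le0 ltW.
have Qp := wQ wp.
have H2 := pot_bottom pot Tq.
have H3 : \sum_(i < 3) bottom_normal b q.2 i 0 * 'D_(eb R i) ('D_ebt Phi) p = 0.
  have sw i : 'D_(eb R i) ('D_ebt Phi) p = 'D_ebt ('D_(eb R i) Phi) p.
    exact: (Ck_on_swap _ _ oQ (Ck_onW _ CPhi) Qp).
  have d i : is_derive p ebt ('D_(eb R i) Phi) ('D_(eb R i) ('D_ebt Phi) p).
    by rewrite sw; apply: C1_is_derive Qp; case: (tu i).
  have H := is_deriveD (is_deriveD (is_deriveZ (bottom_normal b q.2 ord0 0) (d ord0))
    (is_deriveZ (bottom_normal b q.2 (lift ord0 ord0) 0) (d (lift ord0 ord0))))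
    (is_deriveZ (bottom_normal b q.2 (lift ord0 (lift ord0 ord0)) 0)
      (d (lift ord0 (lift ord0 ord0)))).
  rewrite big_ord3; apply: (derive_eq0_line H).
  apply: filterS (near_during Tq) => h Th.
  rewrite shift_ebt; have := pot_bottom pot Th.
  by rewrite big_ord3 !mxE shift_est2 /Defs.bottom shift_est2.
have E i : bottom_normal b q.2 i 0 * green_flux Phi i p =
   Phi p * (bottom_normal b q.2 i 0 * 'D_(eb R i) ('D_ebt Phi) p)
   - 'D_ebt Phi p * (bottom_normal b q.2 i 0 * grad Phi p i 0).
  rewrite [grad _ _ _ _]mxE /green_flux.
  rewrite -[(_ - _) p]/(Phi p * 'D_(eb R i) ('D_ebt Phi) p - 'D_ebt Phi p * 'D_(eb R i) Phi p).
  by ring.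
by rewrite (eq_bigr _ (fun i _ => E i)) sumrB -!mulr_sumr H2 H3 !mulr0 subr0.
Qed.

Lemma production_through_surface t : 0 < t < T ->
  \int[leb3]_(Y in Omega b) production U Phi (t, Y.1, Y.2)
  = \int[leb2]_X production_flux Phi U ver (t, X, 0).
Proof.
move=> tT; rewrite -(water_flux bathy tT oQ wQ tame_production_flux no_flux_production).
apply: eq_Rintegral => Y /[!inE]/= /andP[Y1 Y2].
have wY : water (t, Y.1, Y.2) by split=> //=; exact: ltW.
rewrite (div_production_flux oQ CPhi CU (wQ wY))//.
  by apply: (pot_harmonic pot) => //=; rewrite Y1.
by apply: (bg_divfree bg); exact: water_fluid.
Qed.

Lemma green_through_surface t : 0 < t < T ->
  \int[leb2]_X green_flux Phi ver (t, X, 0) = 0.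
Proof.
move=> tT; rewrite -(water_flux bathy tT oQ wQ tame_green_flux no_flux_green).
have E (Y : R * R * R) : Omega b Y -> divergence (green_flux Phi) (t, Y.1, Y.2) = 0.
  move=> /andP[Y1 Y2].
  have wY : water (t, Y.1, Y.2) by split=> //=; exact: ltW.
  rewrite (div_green_flux CPhi (wQ wY)).
  have lap0 : laplacian Phi (t, Y.1, Y.2) = 0.
    by apply: (pot_harmonic pot) => //=; rewrite Y1.
  rewrite lap0 (laplacian_dt oQ CPhi (wQ wY)); first by rewrite !mulr0 subr0.
  have tY : during T (t, Y.1) by [].
  apply: filterS (near_during tY) => h Th.
  rewrite shift_ebt; apply: (pot_harmonic pot); first exact: Th.
  by rewrite shift_est2 /= Y1.
rewrite Rintegral_mkcond (_ : _ \_ _ = cst 0); first by rewrite Rintegral_cst// mul0r.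
by apply/funext => Y; rewrite patchE; case: ifP => // /set_mem; exact: E.
Qed.

Variable S : set (R * (R * R)).
Hypotheses (oS : open S) (TS : during T `<=` S)
  (teta0 : tame S (during T) (@surface_directions R) r2 eta).

Let P : set (R * (R * R)) := S `&` [set q | Q (q, 0)].

Let oP : open P.
Proof. by apply: openI => //; exact: open_trace0. Qed.

Let TP : during T `<=` P.
Proof. by move=> q Tq; split; [exact: TS|apply: wQ; exact: water_surface]. Qed.

Let teta : tame P (during T) (@surface_directions R) r2 eta.
Proof. by apply: tameS teta0 => // q []. Qed.

Let ttrace w f : tame Q water (@bulk_directions R) w f ->
  tame P (during T) (@surface_directions R) (fun q => w (q, 0)) (trace0 f).
Proof.
move=> tf; apply: (@tameS _ _ [set q | Q (q, 0)] _ (during T) _ (@surface_directions R)) => //.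
  by move=> q [].
apply: (tame_trace0 b_gt0 _ tf) => v; exact: surface_directions_bulk.
Qed.

Let ttrace_es w f : tame Q water (range (eb R)) w f ->
  tame P (during T) (range (es R)) (fun q => w (q, 0)) (trace0 f).
Proof.
move=> tf; apply: (@tameS _ _ [set q | Q (q, 0)] _ (during T) _ (range (es R))) => //.
  by move=> q [].
apply: (tame_trace0 b_gt0 _ tf) => _ [j _ <-]; exists (hor j) => //; exact: eb_hor.
Qed.

Let mul_rr2 (q : R * (R * R)) a c M N : during T q -> `|a| <= M * r2 q ->
  `|c| <= N * r2 q -> `|a * c| <= M * N * q2 q.
Proof. by move=> _; exact: decay_radialM. Qed.

(** The energy density with the trace of [Phi] in place of [phi]: the two agree for [0 < t < T], and
    regularity is given for [Phi]. *)
Definition surface_energy : R * (R * R) -> R :=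
  2^-1 \*o (g \*o (eta * eta) + trace0 Phi * trace0 ('D_(eb R ver) Phi)).

Lemma tame_surface_energy : tame P (during T) (@surface_directions R) q2 surface_energy.
Proof.
apply: (tameZ oP TP); apply: (tameD oP TP).
  by apply: (tameZ oP TP); exact: (tameM oP TP mul_rr2 teta teta).
exact: (tameM oP TP mul_rr2 (ttrace tame_Phi) (ttrace (tame_dPhi (eb_dir ver)))).
Qed.

Lemma energy_densityE q : during T q ->
  energy_density g eta phi Phi q = surface_energy q.
Proof.
move=> Tq; rewrite /energy_density /surface_energy /= -(pot_surface pot Tq).
by rewrite real_normK ?num_real.
Qed.

Let dt_slice (f : R * (R * R) -> R) (t : R) X d :
  is_derive (t, X) est f d -> is_derive t 1 (fun s => f (s, X)) d.
Proof.
move=> /is_derive_add_line H; apply: is_derive_from_line.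
have E h : (t, X) + h *: est = (t + h *: 1, X).
  by congr (_, _); rewrite /= scaler0 addr0.
by under eq_fun do rewrite -E.
Qed.

(** The bound on the time derivative of the density is uniform over []0, T[], which supplies the
    integrable majorant for differentiation under the integral. *)
Lemma is_derive_total_energy (t : R) : 0 < t < T ->
  is_derive t 1 (total_energy g eta phi Phi)
    (\int[leb2]_X 'D_est surface_energy (t, X)).
Proof.
move=> tT.
have [Ce be dbe] := tame_surface_energy.
have [N HN] := dbe est (mem_head _ _).
have nearI (s : R) : 0 < s < T -> \forall r \near s, 0 < r < T.
  move=> sT; have := open_nbhs_nbhs (conj (@interval_open _ (BRight (0 : R)) (BLeft T) isT isT)
    (_ : `]0, T[%classic s)).
  by rewrite /= in_itv/= => /(_ sT); apply: filterS => r; rewrite /= in_itv.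
have dX (s : R) X : 0 < s < T ->
    is_derive s 1 (fun r => energy_density g eta phi Phi (r, X)) ('D_est surface_energy (s, X)).
  move=> sT; apply: (@near_eq_is_derive _ _ _ (fun r => surface_energy (r, X))).
    by apply: filterS (nearI s sT) => r rT; rewrite energy_densityE.
  by apply: dt_slice; apply: (C1_is_derive _ Ce); exact: TP.
have intf (s : R) : `]0, T[%classic s -> leb2.-integrable setT
    (EFin \o (fun X => energy_density g eta phi Phi (s, X))).
  rewrite /= in_itv/= => sT.
  have -> : (fun X => energy_density g eta phi Phi (s, X)) = (fun X => surface_energy (s, X)).
    by apply/funext => X; rewrite energy_densityE.
  apply: (integrable_slice sT _ be) => X.
  by have [c _ _] := Ce (s, X) (TP (sT : during T (s, X))); exact: c.
have It : `]0, T[%classic t by rewrite /= in_itv.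
have derf (s : R) X : `]0, T[%classic s -> setT X ->
    derivable (fun r => energy_density g eta phi Phi (r, X)) s 1.
  by rewrite /= in_itv/= => /(dX s X)[].
have G0 (X : R * R) : 0 <= `|N| * decay2 X by rewrite mulr_ge0 ?decay2_ge0.
have intG : leb2.-integrable setT (EFin \o (fun X : R * R => `|N| * decay2 X)).
  exact: integrable_scaled (integrable_decay2 R).
have Gub (s : R) X : `]0, T[%classic s -> setT X ->
    `|partial1of2 (fun r X => energy_density g eta phi Phi (r, X)) s X| <= `|N| * decay2 X.
  rewrite /= in_itv/= => sT _; rewrite partial1of2E.
  have [_ ->] := dX s X sT; rewrite (le_trans (HN (s, X) sT))//.
  by rewrite ler_wpM2r ?decay2_ge0 ?ler_norm.
have D1 := @derivable_under_integral R _ (measurableTypeR R * measurableTypeR R)%type leb2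
  (fun s X => energy_density g eta phi Phi (s, X)) setT measurableT t 0 T It
  intf derf _ G0 intG Gub.
have D2 := @differentiation_under_integral R _ (measurableTypeR R * measurableTypeR R)%type leb2
  (fun s X => energy_density g eta phi Phi (s, X)) setT measurableT t 0 T It
  intf derf _ G0 intG Gub.
apply: DeriveDef; first exact: D1.
rewrite -derive1E; apply: etrans D2 _; apply: eq_Rintegral => X _.
by rewrite partial1of2E; have [_ ->] := dX t X tT.
Qed.

Let dphi q v : during T q -> 'D_v phi q = 'D_(v, 0) Phi (q, 0).
Proof.
move=> Tq; rewrite -derive_trace0; apply: near_eq_derive.
apply: filterS (open_nbhs_nbhs (conj (@open_during R T) Tq)) => q' Tq'.
by rewrite -(pot_surface pot Tq').
Qed.

(** The integrand of [surface_residue], extended into the bulk so that the bounds on [Phi] and [U]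
    apply to it. *)
Definition residue_density : R * (R * R) * R -> R :=
  2^-1 \*o (('D_(eb R ver) Phi * 'D_(eb R ver) Phi
     - \sum_(j < 2) ('D_(eb R (hor j)) Phi * 'D_(eb R (hor j)) Phi)) * U ver).

Lemma tame_residue_density : tame Q water (range (eb R)) q3 residue_density.
Proof.
apply: (tameZ oQ wQ); apply: (tameM oQ wQ (@mul_w1 q3) _ (tU ver)).
apply: (tameB oQ wQ (tuu ver)); apply: (tame_sum oQ wQ) => j; exact: tuu.
Qed.

Let dphi_hor q j : during T q -> 'D_(es R j) phi q = 'D_(eb R (hor j)) Phi (q, 0).
Proof. by move=> Tq; rewrite eb_hor; exact: dphi. Qed.

Lemma residue_densityE q : during T q ->
  2^-1 * trace0 (U ver) q * ((DtN Phi q) ^+ 2 - \sum_(j < 2) ('D_(es R j) phi q) ^+ 2)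
  = residue_density (q, 0).
Proof.
move=> Tq.
have -> : \sum_(j < 2) ('D_(es R j) phi q) ^+ 2 =
    (\sum_(j < 2) ('D_(eb R (hor j)) Phi * 'D_(eb R (hor j)) Phi)) (q, 0).
  rewrite fct_sumE; apply: eq_bigr => j _; rewrite expr2.
  exact: (congr2 *%R (dphi_hor j Tq) (dphi_hor j Tq)).
by rewrite expr2 -mulrA; congr (_ * _); rewrite [LHS]mulrC.
Qed.

Definition dilation_density : R * (R * R) -> R :=
  (\sum_(j < 2) 'D_(es R j) (trace0 (U (hor j)))) * ((2^-1 * g) \*o (eta * eta)).

Lemma dilation_densityE q :
  div_trace0 U q * (2^-1 * g * `| eta q | ^+ 2) = dilation_density q.
Proof.
rewrite real_normK ?num_real// /div_trace0.
rewrite -[RHS]/((\sum_(j < 2) 'D_(es R j) (trace0 (U (hor j)))) q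
   * (2^-1 * g * (eta q * eta q))) expr2; congr (_ * _).
by rewrite !big_ord_recl !big_ord0.
Qed.

Let tUs j : tame P (during T) (range (es R)) (cst 1) (trace0 (U (hor j))).
Proof. exact: ttrace_es (tU (hor j)). Qed.

Let teta_es : tame P (during T) (range (es R)) r2 eta.
Proof. by apply: tameS teta => //; exact: surface_directions_es. Qed.

Let mul_w1s (w : R * (R * R) -> R) q a c M N : during T q -> `|a| <= M * w q ->
  `|c| <= N * cst 1 q -> `|a * c| <= M * N * w q.
Proof.
move=> _ ha hc; rewrite normrM (le_trans (ler_pM _ _ ha hc))//.
by rewrite /= mulr1 mulrAC.
Qed.

Let teta2 : tame P (during T) (range (es R)) q2 (eta * eta).
Proof. exact: (tameM oP TP mul_rr2 teta_es teta_es). Qed.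

(** From [eta div(U eta) = 1/2 eta^2 div U + 1/2 div(eta^2 U)]: the last divergence integrates to
    zero. *)
Let advected j : R * (R * R) -> R := (eta * eta) * trace0 (U (hor j)).

Let tadvected j : tame P (during T) (range (es R)) q2 (advected j).
Proof. exact: (tameM oP TP (@mul_w1s q2) teta2 (tUs j)). Qed.

(** Continuity and a bound suffice for integrability; the density already contains first derivatives
    of the current. *)
Lemma dilation_density_regular : (forall q, P q -> {for q, continuous dilation_density}) /\
  bounded_by (during T) q2 dilation_density.
Proof.
have es_in j : range (es R) (es R j) by exists j.
split=> [q Pq|].
  apply: cvgM.
    rewrite big_ord_recl big_ord1; apply: cvgD.
      by have [C _ _] := tUs ord0; have [_ _ c] := C q Pq; exact: c.
    by have [C _ _] := tUs (lift ord0 ord0); have [_ _ c] := C q Pq; exact: c.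
  by have [C _ _] := tameZ oP TP (2^-1 * g) teta2; have [c _ _] := C q Pq; exact: c.
rewrite /dilation_density mulrC.
apply: (bounded_byM (@mul_w1s q2)).
  by have [_ B _] := tameZ oP TP (2^-1 * g) teta2; exact: B.
rewrite big_ord_recl big_ord1; apply: bounded_byD.
  by have [_ _ B] := tUs ord0; exact: B.
by have [_ _ B] := tUs (lift ord0 ord0); exact: B.
Qed.

(** The balance at one surface point: [h1] and [h2] are the wave system, [f] the potential, [f0],
    [f1], [w] its gradient, [W] the vertical current. Half the Green flux exchanges [f * wt] for
    [ft * w], after which [ft] and [w] are eliminated by the system. *)
Let energy_algebra (u0 u1 du0 du1 e et e0 e1 f ft f0 f1 w wt W : R) :
  et + ((u0 * e0 + e * du0) + (u1 * e1 + e * du1)) = w ->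
  ft + (u0 * f0 + u1 * f1) = - g * e ->
  2^-1 * (g * (e * et + e * et) + (f * wt + w * ft))
  + ((du0 + du1) * (2^-1 * g * (e * e))
     + (2^-1 * g * (e * e * du0 + u0 * (e * e0 + e * e0))
        + 2^-1 * g * (e * e * du1 + u1 * (e * e1 + e * e1))))
  = 2^-1 * (f * wt - ft * w)
    + ((2^-1 * (f0 * f0 + f1 * f1 + w * w) * W - (f0 * u0 + f1 * u1 + w * W) * w)
       + 2^-1 * ((w * w - (f0 * f0 + f1 * f1)) * W)).
Proof.
move=> h1 h2.
have -> : ft = - g * e - (u0 * f0 + u1 * f1) by rewrite -h2 addrK.
by rewrite -h1; field.
Qed.

Let residue_algebra (w f0 f1 W C : R) : `|W| <= C ->
  `|2^-1 * ((w ^+ 2 - (f0 ^+ 2 + f1 ^+ 2)) * W)| <= C * (f0 ^+ 2 + f1 ^+ 2 + w ^+ 2).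
Proof.
move=> WC; rewrite mulrCA mulrC normrM.
have C0 : 0 <= C := le_trans (normr_ge0 _) WC.
have x0 := sqr_ge0 f0; have y0 := sqr_ge0 f1; have z0 := sqr_ge0 w.
have n1 : `|w ^+ 2 - (f0 ^+ 2 + f1 ^+ 2)| <= f0 ^+ 2 + f1 ^+ 2 + w ^+ 2.
  by rewrite ler_norml; apply/andP; split; lra.
have n2 : `|2^-1 * W| <= C.
  rewrite normrM ger0_norm ?invr_ge0// (le_trans _ WC)// ler_piMl//.
  by rewrite invf_le1// ler1n.
by rewrite ler_pM.
Qed.

Lemma energy_identity q : during T q ->
  'D_est surface_energy q + (dilation_density q +
    (2^-1 * g * 'D_(es R ord0) (advected ord0) q
     + 2^-1 * g * 'D_(es R (lift ord0 ord0)) (advected (lift ord0 ord0)) q))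
  = 2^-1 * green_flux Phi ver (q, 0)
    + (production_flux Phi U ver (q, 0) + residue_density (q, 0)).
Proof.
move=> Tq; have Pq := TP Tq; have Qq : Q (q, 0) by case: Pq.
have [Ceta _ _] := teta.
have [CtPhi _ _] := ttrace tame_Phi.
have [Cw _ _] := ttrace (tame_dPhi (eb_dir ver)).
have CUs j : C1_on P (trace0 (U (hor j))) by have [C _ _] := tUs j; exact: C.
have deta v := C1_is_derive v Ceta Pq.
have dUs j v := C1_is_derive v (@CUs j) Pq.
have deta2 v := is_deriveM (deta v) (deta v).
have dPhit : is_derive q est (trace0 Phi) ('D_ebt Phi (q, 0)).
  by rewrite -(derive_trace0 Phi q est); exact: C1_is_derive CtPhi Pq.
have dwt : is_derive q est (trace0 ('D_(eb R ver) Phi)) ('D_(eb R ver) ('D_ebt Phi) (q, 0)).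
  (* The energy contains the time derivative of ['D_(eb R ver) Phi], the Green flux the vertical
     derivative of ['D_ebt Phi]. *)
  rewrite (Ck_on_swap ebt (eb R ver) oQ (Ck_onW (isT : (2 <= 3)%N) CPhi) Qq).
  by rewrite -(derive_trace0 ('D_(eb R ver) Phi) q est); exact: C1_is_derive Cw Pq.
set u0 := trace0 (U (hor ord0)) q; set u1 := trace0 (U (hor (lift ord0 ord0))) q.
pose du0 := 'D_(es R ord0) (trace0 (U (hor ord0))) q.
pose du1 := 'D_(es R (lift ord0 ord0)) (trace0 (U (hor (lift ord0 ord0)))) q.
pose f0 := 'D_(eb R (hor ord0)) Phi (q, 0).
pose f1 := 'D_(eb R (hor (lift ord0 ord0))) Phi (q, 0).
pose w := 'D_(eb R ver) Phi (q, 0).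
have dE : 'D_est surface_energy q = 2^-1 * (g * (eta q * 'D_est eta q + eta q * 'D_est eta q)
   + (Phi (q, 0) * 'D_(eb R ver) ('D_ebt Phi) (q, 0) + w * 'D_ebt Phi (q, 0))).
  have [_ E] := is_deriveZ 2^-1 (is_deriveD (is_deriveZ g (deta2 est))
    (is_deriveM dPhit dwt)).
  exact: E.
have dA j : 'D_(es R j) (advected j) q = eta q * eta q * 'D_(es R j) (trace0 (U (hor j))) q
   + trace0 (U (hor j)) q * (eta q * 'D_(es R j) eta q + eta q * 'D_(es R j) eta q).
  have [_ E] := is_deriveM (deta2 (es R j)) (dUs j (es R j)).
  exact: E.
have dUe j : 'D_(es R j) (fun q' => trace0 (U (hor j)) q' * eta q') q =
    trace0 (U (hor j)) q * 'D_(es R j) eta q + eta q * 'D_(es R j) (trace0 (U (hor j))) q.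
  have [_ E] := is_deriveM (dUs j (es R j)) (deta (es R j)).
  exact: E.
have H1 : 'D_est eta q + ((u0 * 'D_(es R ord0) eta q + eta q * du0)
    + (u1 * 'D_(es R (lift ord0 ord0)) eta q + eta q * du1)) = w.
  rewrite -[w](wave_eta sys Tq) big_ord_recl big_ord1; congr (_ + _).
  exact: (congr2 +%R (esym (dUe _)) (esym (dUe _))).
have H2 : 'D_ebt Phi (q, 0) + (u0 * f0 + u1 * f1) = - g * eta q.
  rewrite -[RHS](wave_phi sys Tq) big_ord_recl big_ord1.
  exact: (congr2 +%R (esym (dphi _ Tq)) (congr2 +%R
    (congr1 ( *%R _) (esym (dphi_hor _ Tq))) (congr1 ( *%R _) (esym (dphi_hor _ Tq))))).
have dil : dilation_density q = (du0 + du1) * (2^-1 * g * (eta q * eta q)).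
  by rewrite /dilation_density big_ord_recl big_ord1.
have pfE : production_flux Phi U ver (q, 0) =
   2^-1 * (f0 * f0 + f1 * f1 + w * w) * U ver (q, 0)
   - (f0 * u0 + f1 * u1 + w * U ver (q, 0)) * w.
  have S3 (F : 'I_3 -> R * (R * R) * R -> R) :
      \sum_(j < 3) F j = F (hor ord0) + F (hor (lift ord0 ord0)) + F ver.
    by rewrite sum3E big_ord_recl big_ord1.
  by rewrite /production_flux (S3 (fun j => _ * U j)) (S3 (fun j => _ * _)).
have rdE : residue_density (q, 0) = 2^-1 * ((w * w - (f0 * f0 + f1 * f1)) * U ver (q, 0)).
  by rewrite /residue_density big_ord_recl big_ord1.
apply: etrans (congr2 +%R dE (congr2 +%R dil (congr2 +%R
  (congr1 ( *%R _) (dA _)) (congr1 ( *%R _) (dA _))))) _.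
apply: etrans (energy_algebra _ _ _ H1 H2) _.
exact: (congr1 (+%R _) (congr2 +%R (esym pfE) (esym rdE))).
Qed.

Let integrable_trace0 (f : R * (R * R) * R -> R) (t : R) : 0 < t < T ->
  tame Q water (range (eb R)) q3 f ->
  leb2.-integrable setT (EFin \o (fun X => f (t, X, 0))).
Proof.
move=> tT tf; have [Cf bf _] := ttrace_es tf.
apply: (integrable_slice tT _ bf) => X.
by have [c _ _] := Cf (t, X) (TP (tT : during T (t, X))); exact: c.
Qed.

Lemma energy_balance t : 0 < t < T ->
  \int[leb2]_X 'D_est surface_energy (t, X)
  = energy_rate g b U eta Phi t + surface_residue U phi Phi t.
Proof.
move=> tT; have tX X : during T (t, X) by [].
pose a (j : 'I_2) X := 'D_(es R j) (advected j) (t, X).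
have ia j : leb2.-integrable setT (EFin \o (a j)).
  have [C _ B] := tadvected j.
  have Bj : bounded_by (during T) q2 ('D_(es R j) (advected j)) by apply: B; exists j.
  apply: (integrable_slice tT _ Bj) => X.
  by have [_ _ c] := C (t, X) (TP (tX X)); exact: c.
have iE : leb2.-integrable setT (EFin \o (fun X => 'D_est surface_energy (t, X))).
  have [C _ B] := tame_surface_energy.
  have Bt : bounded_by (during T) q2 ('D_est surface_energy) by apply: B; exact: mem_head.
  apply: (integrable_slice tT _ Bt) => X.
  by have [_ _ c] := C (t, X) (TP (tX X)); exact: c.
have iD : leb2.-integrable setT (EFin \o (fun X => dilation_density (t, X))).
  have [c B] := dilation_density_regular.
  by apply: (integrable_slice tT _ B) => X; apply: c; exact: TP.
have iG := integrable_trace0 tT (tame_green_flux ver).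
have iP := integrable_trace0 tT (tame_production_flux ver).
have iR := integrable_trace0 tT tame_residue_density.
have a0 j : \int[leb2]_X a j X = 0.
  exact: (Rintegral_slice_derive0 _ tT TP (tadvected j)).
have isa j := @integrable_scaled R _ _ leb2 (2^-1 * g) _ (ia j).
have isG := @integrable_scaled R _ _ leb2 2^-1 _ iG.
have iaa := integrableD measurableT (isa ord0) (isa (lift ord0 ord0)).
have iDa := integrableD measurableT iD iaa.
have iPR := integrableD measurableT iP iR.
(* The pointwise identity is integrated; the two horizontal derivatives and the Green flux then drop
   out. *)
have E : \int[leb2]_X ('D_est surface_energy (t, X) + (dilation_density (t, X) +
    (2^-1 * g * a ord0 X + 2^-1 * g * a (lift ord0 ord0) X)))
  = \int[leb2]_X (2^-1 * green_flux Phi ver (t, X, 0)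
    + (production_flux Phi U ver (t, X, 0) + residue_density (t, X, 0))).
  by apply: eq_Rintegral => X _; exact: energy_identity (tX X).
have E1 := RintegralD measurableT iE iDa.
have E2 := RintegralD measurableT iD iaa.
have E3 := RintegralD measurableT (isa ord0) (isa (lift ord0 ord0)).
have E4 j := RintegralZl (2^-1 * g) measurableT (ia j).
have E5 := RintegralD measurableT isG iPR.
have E6 := RintegralD measurableT iP iR.
have E7 := RintegralZl 2^-1 measurableT iG.
have Z3 : \int[leb2]_X (2^-1 * g * a ord0 X + 2^-1 * g * a (lift ord0 ord0) X) = 0.
  apply: etrans E3 _; apply: etrans (congr2 +%R (E4 _) (E4 _)) _.
  apply: etrans (congr2 (fun x y => 2^-1 * g * x + 2^-1 * g * y) (a0 _) (a0 _)) _.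
  by rewrite !mulr0 addr0.
have Z7 : \int[leb2]_X (2^-1 * green_flux Phi ver (t, X, 0)) = 0.
  apply: etrans E7 _; apply: etrans (congr1 ( *%R _) (green_through_surface tT)) _.
  exact: mulr0.
have L : \int[leb2]_X 'D_est surface_energy (t, X)
    + \int[leb2]_X dilation_density (t, X)
  = \int[leb2]_X production_flux Phi U ver (t, X, 0)
    + \int[leb2]_X residue_density (t, X, 0).
  apply: etrans (etrans _ (etrans E _)) _.
  - rewrite -[X in _ + X](addr0 (\int[leb2]_X dilation_density (t, X))) -Z3 -E2.
    exact: esym E1.
  - exact: E5.
  - by rewrite Z7 add0r; exact: E6.
have DE : \int[leb2]_X (div_trace0 U (t, X) * (2^-1 * g * `| eta (t, X) | ^+ 2))
    = \int[leb2]_X dilation_density (t, X).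
  by apply: eq_Rintegral => X _; exact: dilation_densityE.
have RE : surface_residue U phi Phi t = \int[leb2]_X residue_density (t, X, 0).
  by apply: eq_Rintegral => X _; exact: residue_densityE (tX X).
rewrite /energy_rate DE RE (production_through_surface tT).
by rewrite -addrA -L addrC addrK.
Qed.

Let speed2 : R * (R * R) * R -> R :=
  \sum_(i < 3) ('D_(eb R i) Phi * 'D_(eb R i) Phi).

Let tspeed2 : tame Q water (range (eb R)) q3 speed2.
Proof. by apply: (tame_sum oQ wQ) => i; exact: tuu. Qed.

(** Pointwise the density is at most [|W|] times the squared speed, and the kinematic condition
    makes [|W|] of order [delta]. *)
Lemma surface_residue_bound t : 0 < t < T ->
  `| surface_residue U phi Phi t |
  <= `|Ks| * (1 + 2 * `|K 0| + `|K 1|) * delta * surface_speed2 Phi t.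
Proof.
move=> tT; have tX X : during T (t, X) by [].
have iR := integrable_trace0 tT tame_residue_density.
have iS := integrable_trace0 tT tspeed2.
set C := `|Ks| * _ * delta.
have RE : surface_residue U phi Phi t = \int[leb2]_X residue_density (t, X, 0).
  by apply: eq_Rintegral => X _; exact: residue_densityE (tX X).
have SE : surface_speed2 Phi t = \int[leb2]_X speed2 (t, X, 0).
  apply: eq_Rintegral => X _; rewrite /speed2 fct_sumE; apply: eq_bigr => i _.
  by rewrite mxE expr2.
rewrite RE SE.
apply: le_trans (le_normr_Rintegral measurableT iR) _.
rewrite -(RintegralZl C measurableT iS).
apply: le_Rintegral.
- exact: measurableT.
- exact: integrable_norm iR.
- exact: integrable_scaled iS.
move=> X _.
have W := vertical_current_surface delta01 b_gt0 bg (tX X).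
have rdE : residue_density (t, X, 0) = 2^-1 * ((('D_(eb R ver) Phi (t, X, 0)) ^+ 2
   - (('D_(eb R (hor ord0)) Phi (t, X, 0)) ^+ 2
     + ('D_(eb R (hor (lift ord0 ord0))) Phi (t, X, 0)) ^+ 2)) * U ver (t, X, 0)).
  by rewrite /residue_density big_ord_recl big_ord1.
have sE : speed2 (t, X, 0) = ('D_(eb R (hor ord0)) Phi (t, X, 0)) ^+ 2
     + ('D_(eb R (hor (lift ord0 ord0))) Phi (t, X, 0)) ^+ 2
     + ('D_(eb R ver) Phi (t, X, 0)) ^+ 2.
  by rewrite /speed2 sum3E big_ord_recl big_ord1.
rewrite rdE sE; move: W; rewrite -/C.
move: ('D_(eb R ver) Phi (t, X, 0)) ('D_(eb R (hor ord0)) Phi (t, X, 0))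
  ('D_(eb R (hor (lift ord0 ord0))) Phi (t, X, 0)) (U ver (t, X, 0)) C.
exact: residue_algebra.
Qed.

End EnergyBalance.

(** The stated equation is exact when the vertical current vanishes at [z = 0]; in general it holds
    up to the residue, which the last clause bounds by [delta] times the squared wave speed at the
    surface. [C] is chosen before all data other than [K], [Ks] and [Kw], so this is a uniform
    [O(delta)]. *)
Theorem proposition8 (R : realType) (K : nat -> R) (Ks Kw : R) :
  exists C : R,
  forall (g delta eps T bmin bmax R0 : R) (b : R * R -> R)
    (U : 'I_3 -> R * (R * R) * R -> R) (etab : R * (R * R) -> R)
    (press : R * (R * R) * R -> R) (patm : R * (R * R) -> R)
    (eta phi : R * (R * R) -> R) (Phi : R * (R * R) * R -> R),
  0 < g -> 0 < delta < 1 -> 0 < eps < 1 ->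
  bathymetry bmin bmax R0 b ->
  background_current K Ks g delta T b U etab press patm ->
  wave_potential T b phi Phi ->
  wave_regular T b eta Phi ->
  wave_small Kw eps T b eta Phi ->
  wave_system g T U eta phi Phi ->
  forall t : R, 0 < t < T ->
  [/\ (forall X, U ver (t, X, 0) = 0) ->
        is_derive t 1 (total_energy g eta phi Phi) (energy_rate g b U eta Phi t),
      is_derive t 1 (total_energy g eta phi Phi)
        (energy_rate g b U eta Phi t + surface_residue U phi Phi t)
    & `| surface_residue U phi Phi t | <= C * delta * surface_speed2 Phi t ].
Proof.
(* The factor in front of [delta] in the bound of the vertical current at [z = 0]. *)
exists (`|Ks| * (1 + 2 * `|K 0| + `|K 1|)) => g delta eps T bmin bmax R0 b U etab
  press patm eta phi Phi _ delta01 _ bathy bg pot reg _ sys t tT.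
have [Q [oQ wQ CPhi CU]] := common_domain bg reg.
have [S [oS TS teta]] := tame_elevation reg.
have D : is_derive t 1 (total_energy g eta phi Phi)
    (energy_rate g b U eta Phi t + surface_residue U phi Phi t).
  rewrite -(energy_balance delta01 bathy bg pot reg sys oQ wQ CPhi CU oS TS teta tT).
  exact: (is_derive_total_energy g bathy pot reg oQ wQ CPhi oS TS teta tT).
split.
- move=> W0; apply: is_derive_eq D _.
  suff -> : surface_residue U phi Phi t = 0 by rewrite addr0.
  rewrite /surface_residue (@eq_Rintegral _ _ _ _ _ (cst 0)).
    by rewrite Rintegral_cst// mul0r.
  by move=> X _; rewrite /trace0 W0 mulr0 mul0r.
- exact: D.
- exact: (surface_residue_bound delta01 bathy bg pot reg oQ wQ CPhi CU TS tT).
Qed.
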